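(* Let $n,m,N$ be positive integers, $p_1,\ldots,p_N,q_1,\ldots,q_N,g_1,\ldots,g_m\in\mathbb{R}[\mathbf{x}]$ with $\mathbf{x}=(x_1,\ldots,x_n)$, $\mathbf{K}=\{\mathbf{x}\mid g_j(\mathbf{x})\ge0,\ j\in[m]\}$ compact with $q_i>0$ on $\mathbf{K}$ for all $i$, and $\rho=\inf_{\mathbf{x}\in\mathbf{K}}\sum_ip_i/q_i$. Suppose $I_1,\ldots,I_N\subseteq[n]$, $J_1,\ldots,J_N\subseteq[m]$ satisfy $[n]=\bigcup I_i$, $[m]=\bigcup J_i$ and: (i) $p_i,q_i\in\mathbb{R}[\mathbf{x}(I_i)]$; (ii) $g_j\in\mathbb{R}[\mathbf{x}(I_i)]$ for $j\in J_i$; (iii) for each $i$ some $k\in J_i$ has $g_k=M_i-\sum_{\ell\in I_i}x_\ell^2$ with $M_i>0$; (iv) for each $i\ge2$, $I_i\cap\bigcup_{j<i}I_j\subseteq I_k$ for some $k<i$. Assume $q_i>0$ on $\mathbf{K}_i=\{\mathbf{z}\in\mathbb{R}^{I_i}\mid g_j(\mathbf{z})\ge0,\ j\in J_i\}$ for all $i$. Then $\rho^{\mathrm{cs}}_k=\rho^{\mathrm{c}}_k$ for all integers $k\ge d_{\min}$, and consequently $\rho^{\mathrm{cs}}_k$ is nondecreasing in $k$ and converges to $\rho$ as $k\to\infty$.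
   Context: $\mathbf{x}(I)=\{x_\ell\mid\ell\in I\}$. $d_j=\lceil\deg g_j/2\rceil$, $d_{\min}=\max\{\lceil\deg p_i/2\rceil,\lceil\deg q_i/2\rceil\ (i\in[N]);d_j\ (j\in[m])\}$. For a sequence $\mathbf{y}=(y_{\boldsymbol{\alpha}})$, $L_{\mathbf{y}}(\sum f_{\boldsymbol{\alpha}}\mathbf{x}^{\boldsymbol{\alpha}})=\sum f_{\boldsymbol{\alpha}}y_{\boldsymbol{\alpha}}$; $\mathbf{M}_k(\mathbf{y})$ has $(\boldsymbol{\alpha},\boldsymbol{\beta})$ entry $y_{\boldsymbol{\alpha}+\boldsymbol{\beta}}$ ($|\boldsymbol{\alpha}|,|\boldsymbol{\beta}|\le k$), and for $f=\sum f_{\boldsymbol{\gamma}}\mathbf{x}^{\boldsymbol{\gamma}}$, $\mathbf{M}_k(f\mathbf{y})$ has entry $\sum_{\boldsymbol{\gamma}}f_{\boldsymbol{\gamma}}y_{\boldsymbol{\gamma}+\boldsymbol{\alpha}+\boldsymbol{\beta}}$. $\mathbf{M}_k(\mathbf{y},I)$, $\mathbf{M}_k(f\mathbf{y},I)$ are principal submatrices indexed by $\boldsymbol{\alpha}$ with $\alpha_\ell=0$ for $\ell\notin I$. $U_i=\{j>i\mid I_i\cap I_j\ne\emptyset\}$. $\mathbb{N}^{(ij)}_s=\{\boldsymbol{\alpha}\in\mathbb{N}^n:|\boldsymbol{\alpha}|\le s,\ \alpha_\ell=0\ \forall\ell\notin I_i\cap I_j\}$. Let $\mathcal{A}=\bigcup_i(\operatorname{supp}p_i\cup\operatorname{supp}q_i)\cup\bigcup_j\operatorname{supp}g_j$,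 $\mathcal{R}=\{\mathbf{r}\in\{0,1\}^n\mid\mathbf{r}^\intercal\boldsymbol{\alpha}\equiv0\ (\mathrm{mod}\,2)\ \forall\boldsymbol{\alpha}\in\mathcal{A}\}$, $\overline{\mathcal{A}}=\{\boldsymbol{\alpha}\in\mathbb{N}^n\mid\mathbf{r}^\intercal\boldsymbol{\alpha}\equiv0\ (\mathrm{mod}\,2)\ \forall\mathbf{r}\in\mathcal{R}\}$. $B^{\mathcal{A}}_{i,s}$ is the $0/1$ matrix indexed by $\{\boldsymbol{\alpha}\in\mathbb{N}^n:|\boldsymbol{\alpha}|\le s,\ \alpha_\ell=0\ \forall\ell\notin I_i\}$ with entry $1$ iff $\boldsymbol{\alpha}+\boldsymbol{\beta}\in\overline{\mathcal{A}}$; $\circ$ is the Hadamard product. $\rho^{\mathrm{c}}_k$ is the infimum of $\sum_iL_{\mathbf{y}_i}(p_i)$ over sequences $\mathbf{y}_i$ (indexed by $\boldsymbol{\alpha}$ with $|\boldsymbol{\alpha}|\le2k$, $\alpha_\ell=0$ for $\ell\notin I_i$) subject to $\mathbf{M}_k(\mathbf{y}_i,I_i)\succeq0$, $\mathbf{M}_{k-d_j}(g_j\mathbf{y}_i,I_i)\succeq0$ ($j\in J_i$), $L_{\mathbf{y}_i}(q_i)=1$ ($i\in[N]$), and $L_{\mathbf{y}_i}(\mathbf{x}^{\boldsymbol{\alpha}}q_i)=L_{\mathbf{y}_j}(\mathbf{x}^{\boldsymbol{\alpha}}q_j)$ for all $\boldsymbol{\alpha}\in\mathbb{N}^{(ij)}_{2k-\max\{\deg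 q_i,\deg q_j\}}$, $j\in U_i$, $i\in[N-1]$. $\rho^{\mathrm{cs}}_k$ is defined identically except that the positivity constraints are $B^{\mathcal{A}}_{i,k}\circ\mathbf{M}_k(\mathbf{y}_i,I_i)\succeq0$ and $B^{\mathcal{A}}_{i,k-d_j}\circ\mathbf{M}_{k-d_j}(g_j\mathbf{y}_i,I_i)\succeq0$, and the linking equalities are imposed only for $\boldsymbol{\alpha}\in\mathbb{N}^{(ij)}_{2k-\max\{\deg q_i,\deg q_j\}}\cap\overline{\mathcal{A}}$. *)

(* Defs.v *)
From HB Require Import structures.
From mathcomp Require Import all_boot all_order all_algebra.
From mathcomp.multinomials Require Import mpoly.
From mathcomp Require Import all_classical all_reals all_analysis.

Set Implicit Arguments.
Unset Strict Implicit.
Unset Printing Implicit Defensive.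

Import Order.TTheory GRing.Theory Num.Theory.
Import numFieldNormedType.Exports.
Local Open Scope ring_scope.
Local Open Scope classical_set_scope.

Notation mono n := (mpoly.multinom n).
Notation mpol R n := (mpoly.mpoly n R).

Definition madd n (a b : mono n) : mono n := mpoly.mnm_add a b.
Definition mdeg n (a : mono n) : nat := mpoly.mdeg a.

Definition mexp n (a : mono n) (l : 'I_n) : nat := mpoly.fun_of_multinom a l.

Definition supported_on n (I : {set 'I_n}) (a : mono n) : bool :=
  [forall l : 'I_n, (l \notin I) ==> (mexp a l == 0%N)].

Definition poly_in (R : realType) n (I : {set 'I_n}) (p : mpol R n) : bool :=
  all (supported_on I) (mpoly.msupp p).

(* total degree (deg 0 := 0) and ceil(deg/2) *)
Definition pdeg (R : realType) n (p : mpol R n) : nat := (\max_(a <- mpoly.msupp p) mpoly.mdeg a)%N.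
Definition hdeg (R : realType) n (p : mpol R n) : nat := uphalf (pdeg p).

Definition ev (R : realType) n (p : mpol R n) (x : 'rV[R]_n) : R :=
  mpoly.meval (fun i => x ord0 i) p.

Definition Lfun (R : realType) n (y : mono n -> R) (f : mpol R n) : R :=
  \sum_(a <- mpoly.msupp f) mpoly.mcoeff a f * y a.

Definition xmon (R : realType) n (a : mono n) : mpol R n := mpoly.mpolyX R a.

Definition locent (R : realType) n (f : mpol R n) (y : mono n -> R)
  (a b : mono n) : R :=
  \sum_(c <- mpoly.msupp f) mpoly.mcoeff c f * y (madd (madd c a) b).

(* Positive semidefiniteness of the (symmetric) matrix A restricted to the
   principal block indexed by {alpha : |alpha| <= s, alpha_l = 0 for l \notin I}:
   v^T A v >= 0 for every real vector v on that index set. *)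
Definition psd_block (R : realType) n (s : nat) (I : {set 'I_n})
  (A : mono n -> mono n -> R) : Prop :=
  forall v : mpoly.bmultinom n s.+1 -> R,
    0 <= \sum_(a : mpoly.bmultinom n s.+1 | supported_on I a)
           \sum_(b : mpoly.bmultinom n s.+1 | supported_on I b)
             v a * A a b * v b.

Definition dmin (R : realType) n m N (p q : 'I_N -> mpol R n)
  (g : 'I_m -> mpol R n) : nat :=
  maxn (\max_(i < N) maxn (hdeg (p i)) (hdeg (q i))) (\max_(j < m) hdeg (g j)).

Definition Aseq (R : realType) n m N (p q : 'I_N -> mpol R n)
  (g : 'I_m -> mpol R n) : seq (mono n) :=
  flatten ([seq mpoly.msupp (p i) ++ mpoly.msupp (q i) | i <- enum 'I_N]
           ++ [seq mpoly.msupp (g j) | j <- enum 'I_m]).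

Definition rdot n (r : {ffun 'I_n -> bool}) (a : mono n) : nat :=
  (\sum_(l < n) (r l : nat) * mexp a l)%N.

Definition in_Rset n (A : seq (mono n)) (r : {ffun 'I_n -> bool}) : bool :=
  all (fun a => ~~ odd (rdot r a)) A.

Definition in_Abar n (A : seq (mono n)) (a : mono n) : bool :=
  [forall r : {ffun 'I_n -> bool}, in_Rset A r ==> ~~ odd (rdot r a)].

(* Feasible set of the correlative-sparse moment relaxation of order k.
   y i is the moment sequence y_i; only its entries indexed by alpha with
   |alpha| <= 2k supported in I_i are ever used by the constraints/objective. *)
Definition feas_c (R : realType) n m N (p q : 'I_N -> mpol R n)
  (g : 'I_m -> mpol R n) (I : 'I_N -> {set 'I_n}) (J : 'I_N -> {set 'I_m})
  (k : nat) (y : 'I_N -> mono n -> R) : Prop :=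
  [/\ forall i, psd_block k (I i) (fun a b => y i (madd a b)),
      forall i j, j \in J i ->
        psd_block (k - hdeg (g j)) (I i) (locent (g j) (y i)),
      forall i, Lfun (y i) (q i) = 1 &
      forall i j : 'I_N, (i < j)%N -> finset.setI (I i) (I j) != finset.set0 ->
        forall a : mono n,
          (mdeg a <= 2 * k - maxn (pdeg (q i)) (pdeg (q j)))%N ->
          supported_on (finset.setI (I i) (I j)) a ->
          Lfun (y i) (xmon R a * q i) = Lfun (y j) (xmon R a * q j)].

(* Same with term sparsity (sign symmetries): Hadamard product with B^A and
   linking equalities only for alpha in Abar. *)
Definition feas_cs (R : realType) n m N (p q : 'I_N -> mpol R n)
  (g : 'I_m -> mpol R n) (I : 'I_N -> {set 'I_n}) (J : 'I_N -> {set 'I_m})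
  (k : nat) (y : 'I_N -> mono n -> R) : Prop :=
  let A := Aseq p q g in
  [/\ forall i, psd_block k (I i)
        (fun a b => if in_Abar A (madd a b) then y i (madd a b) else 0),
      forall i j, j \in J i ->
        psd_block (k - hdeg (g j)) (I i)
          (fun a b => if in_Abar A (madd a b) then locent (g j) (y i) a b else 0),
      forall i, Lfun (y i) (q i) = 1 &
      forall i j : 'I_N, (i < j)%N -> finset.setI (I i) (I j) != finset.set0 ->
        forall a : mono n,
          (mdeg a <= 2 * k - maxn (pdeg (q i)) (pdeg (q j)))%N ->
          supported_on (finset.setI (I i) (I j)) a -> in_Abar A a ->
          Lfun (y i) (xmon R a * q i) = Lfun (y j) (xmon R a * q j)].

Definition obj (R : realType) n N (p : 'I_N -> mpol R n)
  (y : 'I_N -> mono n -> R) : R := \sum_(i < N) Lfun (y i) (p i).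

Definition rho_c (R : realType) n m N (p q : 'I_N -> mpol R n)
  (g : 'I_m -> mpol R n) (I : 'I_N -> {set 'I_n}) (J : 'I_N -> {set 'I_m})
  (k : nat) : \bar R :=
  ereal_inf [set (obj p y)%:E | y in feas_c p q g I J k].

Definition rho_cs (R : realType) n m N (p q : 'I_N -> mpol R n)
  (g : 'I_m -> mpol R n) (I : 'I_N -> {set 'I_n}) (J : 'I_N -> {set 'I_m})
  (k : nat) : \bar R :=
  ereal_inf [set (obj p y)%:E | y in feas_cs p q g I J k].

Definition Kset (R : realType) n m (g : 'I_m -> mpol R n) : set 'rV[R]_n :=
  [set x | forall j, 0 <= ev (g j) x].

Definition rho (R : realType) n m N (p q : 'I_N -> mpol R n)
  (g : 'I_m -> mpol R n) : \bar R :=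
  ereal_inf [set (\sum_(i < N) ev (p i) x / ev (q i) x)%:E | x in Kset g].

(* Main.v *)
(* The two hierarchies coincide at every order: masking with one sign vector r
   averages a form with its image under v_a -> (-1)^(r.a) v_a, so the moments
   of a feasible point stay feasible after masking, and conversely the moments
   outside Abar of a feasible point of the sparser problem may be set to 0.

   For convergence, feasible points of order k with objective at most b' have,
   after normalising the masses, a limit along an ultrafilter: functionals L_i
   on R[x] that are nonnegative on the quadratic module of K_i, with L_i(q_i) = 1
   and compatible on overlaps (L_i lives on R[x(I_i)] and is extended by
   x_l = 0 for l outside I_i).  The mass of the limit is controlled because
   q_i > 0 on K_i.

   Such functionals are nonnegative on polynomials positive on K_i (Putinar):
   the polynomials p with L(h^2 p) >= 0 for all h are closed under products by
   Riesz' iteration p -> p - p^2, hence contain all Bernstein polynomials of a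
   box containing K_i, which settles positivity on the box; and if f > 0 on K_i,
   then f - \sum_j (1 - g_j)^(2k) g_j > 0 on the box for large k, after scaling
   the g_j to be at most 1 there.

   If b < \sum_i p_i / q_i on K, the cliques are split off one at a time in
   reverse running-intersection order: for the overlap S of I_i with the earlier
   cliques there is a polynomial t in x(S) with t below the i-th summand on K_i
   and the sum of the earlier summands plus t still positive.  Moving t to a
   clique containing S does not change \sum_i L_i(q_i T_i) by compatibility, so
   in the end every p_i - (b/N) q_i + q_i T_i is positive on K_i, and summing
   L_i of these gives b <= \sum_i L_i(p_i) <= b'. *)
Require Import Defs.
From HB Require Import structures.
From mathcomp Require Import all_boot all_order all_algebra.
From mathcomp.multinomials Require Import mpoly.
From mathcomp Require Import all_classical all_reals all_analysis.
From mathcomp Require Import ring lra zify.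
Import Order.TTheory GRing.Theory Num.Theory.
Import numFieldNormedType.Exports.
Local Open Scope ring_scope.
Local Open Scope classical_set_scope.

Set Implicit Arguments.
Unset Strict Implicit.
Unset Printing Implicit Defensive.

(* all_analysis has a different Lfun *)
Local Notation Lfun := Defs.Lfun.

(** * Positive multipliers of a functional and Riesz' product argument *)

Section PositiveMultipliers.
Variables (R : realType) (n : nat) (L : {scalar mpol R n}).
Implicit Types p q h : mpol R n.

(** For the form [L (f * h)] this says that multiplication by [p] is a positive operator; closure
    under products is then the commuting-operators theorem [pos_mulM]. *)
Definition pos_mul p : Prop := forall h, 0 <= L (h ^+ 2 * p).

Lemma pos_mulD p q : pos_mul p -> pos_mul q -> pos_mul (p + q).
Proof. by move=> Pp Pq h; rewrite mulrDr raddfD; exact: addr_ge0 (Pp h) (Pq h). Qed.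

Lemma pos_mulZ (c : R) p : 0 <= c -> pos_mul p -> pos_mul (c *: p).
Proof. by move=> c0 Pp h; rewrite -scalerAr linearZ; exact: mulr_ge0 c0 (Pp h). Qed.

Lemma pos_mul_sqr h p : pos_mul p -> pos_mul (h ^+ 2 * p).
Proof. by move=> Pp f; rewrite mulrA -exprMn; exact: Pp. Qed.

Hypothesis pos1 : pos_mul 1.

Lemma pos_sqr h : 0 <= L (h ^+ 2).
Proof. by have := pos1 h; rewrite mulr1. Qed.

Lemma pos_mul_sq h : pos_mul (h ^+ 2).
Proof. by rewrite -[h ^+ 2]mulr1; exact: pos_mul_sqr. Qed.

(* Riesz' proof that a product of commuting positive operators is positive:
   with p_0 = p and p_(k+1) = p_k - p_k^2 one has
   p * q = \sum_(i < k) p_i^2 * q + p_k * q, and L (h^2 * p_k^2) gets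
   arbitrarily small because the sums \sum_i L (h^2 * p_i^2) stay bounded. *)
Let riesz p k := iter k (fun f => f - f ^+ 2) p.

Let riesz_pos p k : pos_mul p -> pos_mul (1 - p) ->
  pos_mul (riesz p k) /\ pos_mul (1 - riesz p k).
Proof.
move=> Pp Pp1; elim: k => [//|k [IH1 IH2]] /=.
set f := riesz p k in IH1 IH2 *; split.
  have -> : f - f ^+ 2 = f ^+ 2 * (1 - f) + (1 - f) ^+ 2 * f by ring.
  by apply: pos_mulD; exact: pos_mul_sqr.
have -> : 1 - (f - f ^+ 2) = (1 - f) + f ^+ 2 by ring.
by apply: pos_mulD => //; exact: pos_mul_sq.
Qed.

Let riesz_sum p k : p = \sum_(i < k) (riesz p i) ^+ 2 + riesz p k.
Proof.
elim: k => [|k IH]; first by rewrite big_ord0 add0r.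
by rewrite big_ord_recr /= {1}IH; ring.
Qed.

Lemma exists_small_term (a : nat -> R) (B e : R) : (forall k, 0 <= a k) ->
  (forall k, \sum_(i < k) a i <= B) -> 0 < e -> exists k, a k < e.
Proof.
move=> a0 aB e0; apply/not_existsP => ae.
have ea k : e <= a k by rewrite leNgt; apply/negP/ae.
have B0 : 0 <= B by have := aB 0; rewrite big_ord0.
have := aB (Num.bound (B / e)); apply/negP; rewrite -ltNge.
apply: (@lt_le_trans _ _ (\sum_(i < Num.bound (B / e)) e)); last exact: ler_sum.
rewrite sumr_const card_ord -[ltRHS]mulr_natl -ltr_pdivrMr //.
by apply: archi_boundP; rewrite divr_ge0 // ltW.
Qed.

Lemma pos_mulM p q : pos_mul p -> pos_mul (1 - p) -> pos_mul q ->
  pos_mul (p * q).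
Proof.
move=> Pp Pp1 Pq h; rewrite leNgt; apply/negP => lt0.
pose a i := L (h ^+ 2 * (riesz p i) ^+ 2).
set D := - L (h ^+ 2 * (p * q)).
have D0 : 0 < D by rewrite oppr_gt0.
set E := L (h ^+ 2 * q ^+ 2) + 1.
have E0 : 0 < E by rewrite ltr_wpDl //; apply: pos_mul_sq.
have DE0 : 0 < D ^+ 2 / E by rewrite divr_gt0 // exprn_gt0.
have [k|k||k ak] := @exists_small_term a (L (h ^+ 2 * p)) (D ^+ 2 / E).
- exact: pos_mul_sq.
- rewrite (riesz_sum p k) mulrDr raddfD mulr_sumr raddf_sum.
  by rewrite lerDl; case: (riesz_pos k Pp Pp1) => + _; apply.
- exact: DE0.
have Hk : L (h ^+ 2 * (riesz p k * q)) <= - D.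
  rewrite opprK {2}(riesz_sum p k) mulrDl mulrDr raddfD lerDr.
  rewrite mulr_suml mulr_sumr raddf_sum sumr_ge0 // => i _.
  exact: pos_mul_sqr.
(* A Cauchy-Schwarz argument. By [Hk] and [a k < D^2 / E], [L] of this square is below E D^2 - 2 E
   D^2 + D^2 (E - 1) = - D^2, a contradiction; the [+ 1] in [E] keeps the division legitimate. *)
have := pos_sqr (E *: (h * riesz p k) + D *: (h * q)).
have -> : (E *: (h * riesz p k) + D *: (h * q)) ^+ 2 =
   E ^+ 2 *: (h ^+ 2 * riesz p k ^+ 2)
   + (E * D * 2) *: (h ^+ 2 * (riesz p k * q)) + D ^+ 2 *: (h ^+ 2 * q ^+ 2).
  by rewrite -!mul_mpolyC !rmorphXn /= !rmorphM /= rmorph_nat; ring.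
rewrite !raddfD /= !linearZ /= -/(a k); apply/negP; rewrite -ltNge.
have ED : 0 <= E * D * 2 by rewrite !mulr_ge0 // ltW.
have := ler_wpM2l ED Hk.
move: ak; rewrite ltr_pdivlMr // => ak.
have : E * (a k * E) < E * D ^+ 2 by rewrite ltr_pM2l.
have -> : L (h ^+ 2 * q ^+ 2) = E - 1 by rewrite addrK.
have : 0 < D ^+ 2 by rewrite exprn_gt0.
nra.
Qed.

End PositiveMultipliers.

(** * Bernstein expansion and positivity on the unit cube *)

Section Bernstein.

(** Factorial moments of the binomial distribution. Absorption of [j.+1] into ['C(k.+1, j.+1)] takes
    out a factor [k.+1 * x] and lowers [a] by one. A general commutative ring lets [x] be a
    polynomial. *)
Lemma bernstein_ffact (A : comNzRingType) (x : A) a k :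
  \sum_(j < k.+1) ('C(k, j) * j ^_ a)%:R * (x ^+ j * (1 - x) ^+ (k - j)) =
  (k ^_ a)%:R * x ^+ a.
Proof.
elim: a k => [|a IH] k.
  rewrite expr0 ffactn0 mulr1 -[1%:R](expr1n A k) -{3}(subrK x 1) exprDn.
  by apply: eq_bigr => j _; rewrite ffactn0 muln1 mulr_natl [x ^+ j * _]mulrC.
case: k => [|k].
  by rewrite big_ord_recl big_ord0 !ffact0n muln0 !mul0r addr0.
rewrite big_ord_recl ffact0n muln0 mul0r add0r.
rewrite ffactSS exprSr natrM.
transitivity (k.+1%:R * x * ((k ^_ a)%:R * x ^+ a)); last by ring.
rewrite -IH mulr_sumr; apply: eq_bigr => j _.
rewrite lift0 subSS ffactSS mulnA [('C(_, _) * _)%N]mulnC -mul_bin_diag.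
by rewrite exprS !natrM; ring.
Qed.

Variable R : realType.

Lemma le_norm_prodB (I : Type) (r : seq I) (x y : I -> R) :
  (forall i, 0 <= x i <= 1) -> (forall i, 0 <= y i <= 1) ->
  `|\prod_(i <- r) x i - \prod_(i <- r) y i| <= \sum_(i <- r) `|x i - y i|.
Proof.
move=> x01 y01; elim: r => [|i r IH]; first by rewrite !big_nil subrr normr0.
rewrite !big_cons; set X := \prod_(j <- r) x j in IH *.
set Y := \prod_(j <- r) y j in IH *.
have -> : x i * X - y i * Y = (x i - y i) * X + y i * (X - Y) by ring.
have X1 : 0 <= X <= 1.
  rewrite prodr_ge0 /=; last by move=> j _; case/andP: (x01 j).
  by apply: prodr_ile1 => j _; exact: x01.
case/andP: X1 => X0 X1; case/andP: (y01 i) => yi0 yi1.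
apply: (le_trans (ler_normD _ _)); apply: lerD.
  by rewrite normrM (ger0_norm X0) ler_piMr.
apply: le_trans IH; by rewrite normrM (ger0_norm yi0) ler_piMl.
Qed.

(** By [bernstein_ffact], the coefficients of [x ^+ a] in the Bernstein basis of degree [k]. *)
Definition ffact_ratio (k a j : nat) : R := (j ^_ a)%:R / (k ^_ a)%:R.

Lemma ffact_ratioS k a j :
  ffact_ratio k a.+1 j = ffact_ratio k a j * ((j - a)%:R / (k - a)%:R).
Proof. by rewrite /ffact_ratio !ffactnSr !natrM invfM; ring. Qed.

Lemma natr_ratio01 j k : (j <= k)%N -> 0 <= (j%:R / k%:R : R) <= 1.
Proof.
move=> jk; rewrite divr_ge0 //=.
have [->|k0] := eqVneq k 0%N; first by rewrite invr0 mulr0.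
by rewrite ler_pdivrMr ?ltr0n ?lt0n // mul1r ler_nat.
Qed.

Lemma ffact_ratio01 k a j : (j <= k)%N -> 0 <= ffact_ratio k a j <= 1.
Proof.
move=> jk; elim: a => [|a /andP[IH0 IH1]].
  by rewrite /ffact_ratio !ffactn0 divr1 ler01 lexx.
have /andP[u0 u1] := natr_ratio01 (leq_sub2r a jk).
by rewrite ffact_ratioS mulr_ge0 //= mulr_ile1.
Qed.

(** The ratio is a product of the factors [(j - i) / (k - i)] for [i < a], each within [b / (k - b)]
    of [j / k]; the errors add up because all factors lie in [0, 1]. *)
Lemma ffact_ratio_approx k a b j : (a <= b < k)%N -> (j <= k)%N ->
  `|ffact_ratio k a j - (j%:R / k%:R) ^+ a| <= a%:R * (b%:R / (k - b)%:R).
Proof.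
move=> /andP[ab bk] jk; elim: a ab => [|a IH] ab.
  by rewrite /ffact_ratio !ffactn0 divr1 expr0 subrr normr0 mul0r.
have ak : (a < k)%N := ltn_trans ab bk.
have k0 : 0 < k%:R :> R by rewrite ltr0n (leq_trans _ ak).
have kb0 : 0 < (k - b)%:R :> R by rewrite ltr0n subn_gt0.
have ka0 : 0 < (k - a)%:R :> R by rewrite ltr0n subn_gt0.
have abR : a%:R <= b%:R :> R by rewrite ler_nat ltnW.
have kba : (k - b)%:R <= (k - a)%:R :> R by rewrite ler_nat leq_sub2l // ltnW.
have kbk : (k - b)%:R <= k%:R :> R by rewrite ler_nat leq_subr.
rewrite ffact_ratioS exprSr; set u := (j - a)%:R / (k - a)%:R.
set v := j%:R / k%:R; set w := ffact_ratio _ _ _.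
have /andP[u0 u1] : 0 <= u <= 1 by apply: natr_ratio01; exact: leq_sub2r.
have /andP[v0 v1] : 0 <= v <= 1 by exact: natr_ratio01.
have -> : w * u - v ^+ a * v = (w - v ^+ a) * u + v ^+ a * (u - v) by ring.
have va : 0 <= v ^+ a <= 1 by rewrite exprn_ge0 //= exprn_ile1.
case/andP: va => va0 va1.
apply: (le_trans (ler_normD _ _)); rewrite -natr1 [leRHS]mulrDl mul1r; apply: lerD.
  rewrite normrM (ger0_norm u0); apply: le_trans (IH (ltnW ab)).
  by rewrite ler_piMr.
rewrite normrM (ger0_norm va0).
apply: (@le_trans _ _ `|u - v|); first by rewrite ler_piMl.
have jkR : j%:R <= k%:R :> R by rewrite ler_nat.
have j0R : 0 <= j%:R :> R by [].
have a0R : 0 <= a%:R :> R by [].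
rewrite ler_pdivlMr //.
have [aj|ja] := leqP a j.
  have -> : u - v = - (a%:R * (k%:R - j%:R) / (k%:R * (k - a)%:R)).
    move: ka0; rewrite /u /v !natrB // ?(ltnW ak) // => ka0.
    by field; rewrite !gt_eqF.
  rewrite normrN ger0_norm; last by rewrite divr_ge0 ?mulr_ge0 // subr_ge0.
  rewrite mulrAC ler_pdivrMr ?mulr_gt0 //.
  rewrite -!mulrA; apply: ler_pM => //.
    by rewrite mulr_ge0 // ?subr_ge0 // ltW.
  apply: ler_pM => //; first by rewrite subr_ge0.
    by rewrite gerBl.
(* For [j < a] the truncated subtraction makes the factor vanish, and [j / k] itself is small
   enough. *)
have -> : u = 0.
  by move: (ltnW ja); rewrite -subn_eq0 /u => /eqP ->; rewrite mul0r.
have jb : j%:R <= b%:R :> R by rewrite ler_nat (leq_trans (ltnW ja)) // ltnW.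
rewrite sub0r normrN ger0_norm // /v mulrAC ler_pdivrMr //.
by apply: ler_pM.
Qed.

Variables (n : nat) (L : {scalar mpol R n}) (u : n.-tuple (mpol R n)).
Hypotheses (pos1 : pos_mul L 1) (posu : forall l, pos_mul L (tnth u l))
  (posu1 : forall l, pos_mul L (1 - tnth u l)).

Let bern k (J : {ffun 'I_n -> 'I_k.+1}) : mpol R n :=
  \prod_(l < n) ('C(k, J l)%:R *:
    (tnth u l ^+ J l * (1 - tnth u l) ^+ (k - J l))).

Let pos_bern k J : pos_mul L (@bern k J).
Proof.
have powpos p a q : pos_mul L p -> pos_mul L (1 - p) -> pos_mul L q ->
    pos_mul L (p ^+ a * q).
  move=> Pp Pp1 Pq; elim: a => [|a IH]; first by rewrite expr0 mul1r.
  by rewrite exprS -mulrA; exact: pos_mulM.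
rewrite /bern; elim/big_rec: _ => // l q _ Pq.
rewrite -scalerAl -mulrA; apply: pos_mulZ => //.
apply: (powpos) => //; apply: (powpos) => //.
by rewrite opprB addrC subrK.
Qed.

Let mono_bern k (a : mono n) : (forall l, a l <= k)%N ->
  \prod_(l < n) tnth u l ^+ a l =
  \sum_(J : {ffun 'I_n -> 'I_k.+1})
     (\prod_(l < n) ffact_ratio k (a l) (J l)) *: bern J.
Proof.
move=> ak; transitivity (\prod_(l < n) \sum_(j < k.+1)
   (ffact_ratio k (a l) j * 'C(k, j)%:R) *:
    (tnth u l ^+ j * (1 - tnth u l) ^+ (k - j))).
  apply: eq_bigr => l _.
  have fk0 : (k ^_ a l)%:R != 0 :> R.
    by rewrite pnatr_eq0 -lt0n ffact_gt0.
  apply: (scalerI fk0); rewrite scaler_sumr.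
  transitivity ((k ^_ a l)%:R * tnth u l ^+ a l).
    by rewrite scaler_nat mulr_natl.
  rewrite -bernstein_ffact; apply: eq_bigr => j _.
  have E : (k ^_ a l)%:R * (ffact_ratio k (a l) j * 'C(k, j)%:R) =
      ('C(k, j) * j ^_ a l)%:R.
    by rewrite /ffact_ratio natrM; field.
  by rewrite scalerA E scaler_nat mulr_natl.
rewrite bigA_distr_bigA /=; apply: eq_bigr => J _.
by rewrite /bern !scaler_prod scalerA big_split.
Qed.

(** The Bernstein coefficient of [f] at [J] approximates the value of [f] at the grid point [J / k].
    Once the error is below [d] all coefficients are nonnegative, and Bernstein products are
    positive multipliers by [pos_mulM]. *)
Lemma bernstein_pos (f : mpol R n) (d : R) : 0 < d ->
  (forall x : 'I_n -> R, (forall l, 0 <= x l <= 1) -> d <= f.@[x]) ->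
  0 <= L (f \mPo u).
Proof.
move=> d0 fd; pose b := msize f.
have mb m l : m \in msupp f -> (m l < b)%N.
  move=> /msize_mdeg_lt; apply: leq_ltn_trans.
  by rewrite mdegE (bigD1 l) //= leq_addr.
pose S : R := \sum_(m <- msupp f) `|f@_m|.
pose c : R := S * (n%:R * (b%:R * b%:R)).
(* With [k - b = b'], [ffact_ratio_approx] gives a total error of at most [c / b'], hence at most
   [d]. *)
pose b' := (Num.bound (c / d)).+1; pose k := (b + b')%N.
have bk : (b < k)%N by rewrite /k -addSnnS leq_addr.
have c0 : 0 <= c by rewrite mulr_ge0 // sumr_ge0.
have cb : c / b'%:R <= d.
  rewrite ler_pdivrMr // mulrC -ler_pdivrMr //.
  apply: ltW; apply: (lt_le_trans (archi_boundP _)); first by rewrite divr_ge0 // ltW.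
  by rewrite ler_nat.
have -> : f \mPo u = \sum_(J : {ffun 'I_n -> 'I_k.+1})
    (\sum_(m <- msupp f) f@_m * \prod_(l < n) ffact_ratio k (m l) (J l)) *: bern J.
  rewrite comp_mpolyE.
  under [RHS]eq_bigr do rewrite scaler_suml.
  rewrite exchange_big /= big_seq [RHS]big_seq; apply: eq_bigr => m mf.
  rewrite (@mono_bern k) => [|l]; last by rewrite ltnW // (ltn_trans (mb _ _ mf)).
  by rewrite scaler_sumr; apply: eq_bigr => J _; rewrite scalerA.
rewrite raddf_sum /= sumr_ge0 // => J _; rewrite linearZ /= mulr_ge0 //; last first.
  by have := @pos_bern k J 1; rewrite expr1n mul1r.
pose x l : R := (J l)%:R / k%:R.
have Jk l : (J l <= k)%N by rewrite -ltnS.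
have x01 l : 0 <= x l <= 1 by exact: natr_ratio01.
have := fd _ x01; rewrite mevalE => dx.
rewrite -subr_ge0 in dx; apply: (le_trans dx).
rewrite lerBlDr -lerBlDl -sumrB.
apply: le_trans cb; rewrite big_seq.
apply: (@le_trans _ _ (\sum_(m <- msupp f | m \in msupp f)
   `|f@_m| * (n%:R * (b%:R * (b%:R / b'%:R))))).
  apply: ler_sum => m mf; rewrite -mulrBr.
  apply: (le_trans (ler_norm _)); rewrite normrM ler_wpM2l //.
  rewrite distrC; apply: (le_trans (le_norm_prodB _ _ _)) => //.
  - by move=> l; exact: ffact_ratio01.
  - by move=> l; rewrite exprn_ge0 ?exprn_ile1 //; case/andP: (x01 l).
  apply: (@le_trans _ _ (\sum_(l < n) (b%:R * (b%:R / b'%:R)))).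
    apply: ler_sum => l _; have mlb := mb m l mf.
    have := @ffact_ratio_approx k (m l) b (J l); rewrite bk (ltnW mlb) => /(_ isT (Jk l)).
    rewrite /k addKn => /le_trans; apply.
    by rewrite ler_wpM2r ?divr_ge0 // ler_nat ltnW.
  by rewrite sumr_const card_ord -[leLHS]mulr_natl.
by rewrite -big_seq -mulr_suml /c !mulrA.
Qed.

End Bernstein.

(** * Continuity of polynomials and compactness *)

Section Continuity.
Variables (R : realType) (n : nat).

Lemma ev_continuous (p : mpol R n) : continuous (@ev R n p).
Proof.
have prodc (a : mono n) (s : seq 'I_n) :
    continuous (fun x : 'rV[R]_n => \prod_(l <- s) x ord0 l ^+ a l).
  elim: s => [|l s IH].
    rewrite (_ : (fun _ => _) = cst 1); first exact: cst_continuous.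
    by apply/funext => x; rewrite big_nil.
  rewrite (_ : (fun _ => _) =
    (fun x : 'rV[R]_n => x ord0 l ^+ a l * \prod_(i <- s) x ord0 i ^+ a i)); last first.
    by apply/funext => x; rewrite big_cons.
  move=> x; apply: (@continuousM R 'rV[R]_n (fun y : 'rV[R]_n => y ord0 l ^+ a l)
     (fun y => \prod_(i <- s) y ord0 i ^+ a i)); last exact: IH.
  apply: (@continuous_comp _ _ _ (fun y : 'rV[R]_n => y ord0 l) (fun t => t ^+ a l)).
    exact: coord_continuous.
  exact: exprn_continuous.
elim/mpolyind: p => [|c a p _ _ IH].
  by rewrite (_ : ev 0 = cst 0); [exact: cst_continuous|apply/funext => x; exact: meval0].
rewrite (_ : ev _ = fun x => c * \prod_(l < n) x ord0 l ^+ a l + ev p x); last first.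
  by apply/funext => x; rewrite /ev mevalD mevalZ mevalX.
move=> x; apply: (@continuousD _ R 'rV[R]_n
  (fun y => c * \prod_(l < n) y ord0 l ^+ a l)); last exact: IH.
apply: (@continuousM R 'rV[R]_n (cst c)); last exact: prodc.
exact: cst_continuous.
Qed.

Lemma ev_near_lt (p : mpol R n) (x : 'rV[R]_n) a :
  ev p x < a -> \forall y \near x, ev p y < a.
Proof. exact: (cvgr_lt _ (@ev_continuous p x)). Qed.

Lemma ev_near_gt (p : mpol R n) (x : 'rV[R]_n) a :
  a < ev p x -> \forall y \near x, a < ev p y.
Proof. exact: (cvgr_gt _ (@ev_continuous p x)). Qed.

(** A lower bound instead of an attained minimum, so that [K] may be empty. *)
Lemma compact_min_pos (T : topologicalType) (K : set T) (f : T -> R) :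
  compact K -> (forall x, K x -> f @ x --> f x) ->
  (forall x, K x -> 0 < f x) -> exists2 d, 0 < d & forall x, K x -> d <= f x.
Proof.
move=> /compact_near_coveringP Kc fc f0.
have : \forall d \near 0^'+, K `<=` (fun x => d <= f x).
  apply: Kc => x Kx; have fx0 := f0 x Kx.
  have fx2 : 0 < f x / 2 by rewrite divr_gt0.
  near=> y d => /=.
  apply: ltW; apply: (@lt_trans _ _ (f x / 2)).
    by near: d; exact: nbhs_right_lt.
  near: y; apply: (cvgr_gt _ (fc x Kx)).
  by rewrite ltr_pdivrMr // mulr_natr mulr2n ltrDl.
move=> H; have [d [d0 dK]] := filter_ex (filterI (nbhs_right_gt (0 : R)) H).
by exists d.
Unshelve. all: by end_near. Qed.

Definition box (c : R) : set 'rV[R]_n := [set x | forall l, - c <= x ord0 l <= c].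

Lemma box_compact c : compact (box c).
Proof.
have := @rV_compact R n (fun=> `[- c, c]%classic) (fun=> @segment_compact _ _ _).
by congr compact; apply/seteqP; split=> x /= H l; have := H l; rewrite /= in_itv.
Qed.

End Continuity.

(** * Positivity on a box *)

Section BoxPositivity.
Variables (R : realType) (n : nat) (L : {scalar mpol R n}) (c : R).
Hypotheses (c0 : 0 < c) (pos1 : pos_mul L 1)
  (posD : forall l, pos_mul L (c%:MP + 'X_l))
  (posB : forall l, pos_mul L (c%:MP - 'X_l)).

Lemma box_pos f : (forall x, box c x -> 0 < ev f x) -> 0 <= L f.
Proof.
move=> f0.
have [d d0 df] := compact_min_pos (@box_compact R n c)
  (fun x _ => @ev_continuous R n f x) f0.
(* [u] maps the box affinely onto the unit cube and [v] is its inverse, so [bernstein_pos] applies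
   to [f \mPo v]. *)
pose v := [tuple (2 * c) *: 'X_l - c%:MP | l < n] : n.-tuple (mpol R n).
pose u := [tuple (2 * c)^-1 *: (c%:MP + 'X_l) | l < n] : n.-tuple (mpol R n).
have c20 : 2 * c != 0 by rewrite gt_eqF // mulr_gt0.
have c21 : 0 <= (2 * c)^-1 by rewrite invr_ge0 mulr_ge0 // ltW.
have -> : f = (f \mPo v) \mPo u.
  rewrite {1}(mpolyE f) (comp_mpolyE f v) raddf_sum /=; apply: eq_bigr => a _.
  rewrite comp_mpolyZ rmorph_prod /= mpolyXE_id; congr (_ *: _).
  apply: eq_bigr => l _; rewrite rmorphXn /= tnth_mktuple raddfB /= comp_mpolyZ.
  rewrite comp_mpolyC comp_mpolyXU -tnth_nth tnth_mktuple scalerA divff //.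
  by rewrite scale1r addrC addKr.
apply: (bernstein_pos _ _ _ d0) => // [l|l|x x01].
- by rewrite tnth_mktuple; exact: pos_mulZ.
- rewrite tnth_mktuple (_ : 1 - _ = (2 * c)^-1 *: (c%:MP - 'X_l)).
    exact: pos_mulZ.
  apply: (scalerI c20); rewrite scalerBr !scalerA divff // !scale1r.
  by rewrite alg_mpolyC mulr2n mulrDl mul1r rmorphD /= opprD addrACA subrr add0r.
have := df (\row_l (2 * c * x l - c)); rewrite /ev comp_mpoly_meval.
rewrite (@meval_eq _ _ (fun i => (\row_l _) ord0 i) (fun l => (tnth v l).@[x])).
  apply => l; rewrite mxE; case/andP: (x01 l) => xl0 xl1; apply/andP.
  have cx0 : 0 <= c * x l by rewrite mulr_ge0 // ltW.
  have cx1 : 0 <= c * (1 - x l) by rewrite mulr_ge0 ?subr_ge0 // ltW.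
  by rewrite mulrBr mulr1 in cx1; split; lra.
by move=> l; rewrite mxE tnth_mktuple mevalB mevalZ mevalXU mevalC.
Qed.

End BoxPositivity.

(** * Putinar's theorem, in its dual form for functionals *)

Section Putinar.
Variable R : realType.

Lemma bernoulli_ge (x : R) k : -1 <= x -> 1 + k%:R * x <= (1 + x) ^+ k.
Proof.
move=> x1; elim: k => [|k IH]; first by rewrite mul0r addr0 expr0.
have x10 : 0 <= 1 + x by rewrite -lerBlDl sub0r.
rewrite exprS; apply: le_trans (ler_wpM2l x10 IH).
rewrite -natr1; have : 0 <= k%:R * x ^+ 2 by rewrite mulr_ge0 // sqr_ge0.
nra.
Qed.

(** Since (1 - x)^k (1 + x)^k <= 1, it is enough that [k%:R * x] is at most [(1 + x) ^+ k], which is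
    Bernoulli's inequality. *)
Lemma mul_pow1B_le (x : R) k : 0 <= x <= 1 -> k%:R * (x * (1 - x) ^+ k) <= 1.
Proof.
case/andP=> x0 x1.
have y0 : 0 <= (1 - x) ^+ k by rewrite exprn_ge0 // subr_ge0.
have : (1 - x) ^+ k * (1 + x) ^+ k <= 1.
  by rewrite -exprMn exprn_ile1 //; nra.
apply: le_trans; rewrite mulrA mulrC ler_wpM2l //.
apply: le_trans (bernoulli_ge k _); last by lra.
by rewrite lerDr.
Qed.

Variables (n m : nat) (L : {scalar mpol R n}) (c : R) (g : 'I_m -> mpol R n)
  (J : {set 'I_m}).
Hypotheses (c0 : 0 < c) (pos1 : pos_mul L 1)
  (posD : forall l, pos_mul L (c%:MP + 'X_l))
  (posB : forall l, pos_mul L (c%:MP - 'X_l))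
  (posg : forall j, j \in J -> pos_mul L (g j)).

(** The Archimedean condition enters through [posD] and [posB]. The correction subtracted in [F k]
    costs little where all constraints hold and gains without bound where one fails, so [F k] is
    positive on the whole box for one large [k], and [box_pos] applies to it. *)
Theorem putinar f :
  (forall x, box c x -> (forall j, j \in J -> 0 <= ev (g j) x) -> 0 < ev f x) ->
  0 <= L f.
Proof.
move=> f0.
have /compact_near_coveringP boxc := @box_compact R n c.
have [C [C0 Cg]] : exists C : R, 0 < C /\
    forall x, box c x -> forall j, ev (g j) x <= C.
  have : \forall C \near +oo, forall j, box c `<=` (fun x => ev (g j) x <= C).
    apply: filter_forall => j; apply: boxc => x _.
    near=> y C => /=; apply: (@le_trans _ _ (ev (g j) x + 1)); last first.
      by near: C; apply: nbhs_pinfty_ge; exact: num_real.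
    apply: ltW; near: y; apply: ev_near_lt.
    by rewrite ltrDl.
  move=> H; have [C [C0 CK]] := filter_ex (filterI (nbhs_pinfty_gt (num_real 0)) H).
  by exists C; split => // x bx j; exact: CK.
pose h j := C^-1 *: g j.
have h1 x j : box c x -> ev (h j) x <= 1.
  by move=> /Cg /(_ j) ?; rewrite /ev mevalZ mulrC ler_pdivrMr // mul1r.
have posh j : j \in J -> pos_mul L (h j).
  by move=> jJ; apply: pos_mulZ (posg jJ); rewrite invr_ge0 ltW.
have hf x : box c x -> (forall j, j \in J -> 0 <= ev (h j) x) -> 0 < ev f x.
  move=> bx hx; apply: f0 => // j /hx; rewrite /ev mevalZ pmulr_rge0 //.
  by rewrite invr_gt0.
pose F k := f - \sum_(j in J) ((1 - h j) ^+ k) ^+ 2 * h j.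
have evF k x : ev (F k) x = ev f x - \sum_(j in J) ev (h j) x * (1 - ev (h j) x) ^+ (k * 2).
  rewrite /ev /F mevalB; congr (_ - _); rewrite rmorph_sum /=; apply: eq_bigr => j _.
  by rewrite mevalM -exprM rmorphXn /= mevalB meval1 mulrC.
(* Valid whatever the sign of [h j]: a negative value makes the left side nonpositive. *)
have term k x j : box c x -> ev (h j) x * (1 - ev (h j) x) ^+ (k * 2) * k%:R <= 1.
  move=> /(@h1 x j); set t := ev _ _ => t1.
  have y0 : 0 <= (1 - t) ^+ (k * 2) by rewrite exprM sqr_ge0.
  have [t0|t0] := leP 0 t.
    have := @mul_pow1B_le t (k * 2)%N; rewrite t0 t1 => /(_ isT).
    apply: le_trans; rewrite mulrC ler_wpM2r //; first by rewrite mulr_ge0.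
    by rewrite ler_nat leq_pmulr.
  by apply: le_trans ler01; rewrite mulr_le0_ge0 // mulr_le0_ge0 // ltW.
suff [k Fk] : exists k, forall x, box c x -> 0 < ev (F k) x.
  have -> : f = F k + \sum_(j in J) ((1 - h j) ^+ k) ^+ 2 * h j by rewrite subrK.
  rewrite raddfD /= raddf_sum /= addr_ge0 //; first exact: box_pos Fk.
  by apply: sumr_ge0 => j jJ; exact: posh.
have : \forall k \near \oo, box c `<=` (fun x => 0 < ev (F k) x).
  move/near_covering_withinP : (boxc); apply => x bx.
  have [hx|/existsNP[j /not_implyP [jJ /negP]]] :=
      pselect (forall j, j \in J -> 0 <= ev (h j) x).
    have fx0 := hf x bx hx.
    near=> y k => /= bY; rewrite evF subr_gt0.
    have k0 : 0 < k%:R :> R by near: k; exact: nbhs_infty_gtr.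
    apply: (@le_lt_trans _ _ (m%:R / k%:R)).
      apply: (@le_trans _ _ (\sum_(j in J) k%:R^-1)).
        by apply: ler_sum => j jJ; rewrite -[k%:R^-1]mul1r ler_pdivlMr // term.
      rewrite sumr_const -[leLHS]mulr_natl ler_wpM2r ?invr_ge0 ?(ltW k0) //.
      by rewrite ler_nat -[leqRHS]card_ord max_card.
    apply: (@lt_trans _ _ (ev f x / 2)).
      rewrite ltr_pdivrMr // mulrC -ltr_pdivrMr ?divr_gt0 //.
      by near: k; exact: nbhs_infty_gtr.
    near: y; apply: ev_near_gt.
    by rewrite ltr_pdivrMr // mulr_natr mulr2n ltrDl.
  (* Near a point violating constraint [j], Bernoulli bounds the [j]-th term by [- (e * e) * k],
     while the other terms add up to at most [m]. *)
  rewrite -ltNge => hj0; set e := - ev (h j) x / 2.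
  have e0 : 0 < e by rewrite divr_gt0 // oppr_gt0.
  near=> y k => /= bY; rewrite evF subr_gt0.
  have k1 : 1 < k%:R :> R by near: k; exact: nbhs_infty_gtr.
  have k0 : 0 < k%:R :> R by exact: lt_trans k1.
  rewrite (bigD1 j) //=; set t := ev (h j) y.
  have te : t < - e.
    rewrite /t; near: y; apply: ev_near_lt.
    by move: hj0; rewrite /e; set w := ev _ _ => ?; lra.
  have H1 : t * (1 - t) ^+ (k * 2) <= - (e * (e * k%:R)).
    have : 1 + (k * 2)%:R * (- t) <= (1 - t) ^+ (k * 2).
      by apply: bernoulli_ge; lra.
    rewrite natrM => H; have : e * k%:R <= (1 - t) ^+ (k * 2).
      by apply: le_trans H; nra.
    have : 0 < e * k%:R by rewrite mulr_gt0.
    by set w := e * _; set z := _ ^+ _ => ? ?; nra.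
  have H2 : \sum_(i in J | i != j) ev (h i) y * (1 - ev (h i) y) ^+ (k * 2) <= m%:R.
    apply: (@le_trans _ _ (\sum_(i in J | i != j) 1)).
      apply: ler_sum => i _; have := term k y i bY.
      by rewrite -ler_pdivlMr // => /le_trans; apply; rewrite mul1r invf_le1 // ltW.
    rewrite sumr_const ler_nat.
    by rewrite -[leqRHS]card_ord max_card.
  have H3 : ev f x - 1 < ev f y.
    near: y; apply: ev_near_gt.
    by rewrite ltrBlDr ltrDl.
  have H4 : (m%:R + 1 - ev f x) / (e * e) < k%:R.
    by near: k; exact: nbhs_infty_gtr.
  have ee0 : 0 < e * e by exact: mulr_gt0.
  rewrite ltr_pdivrMr // in H4.
  move: H1 H2 H3 H4; set A := t * _; set B := \sum_(_ in _ | _) _.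
  rewrite mulrA [_ * (e * e)]mulrC.
  move=> ? ? ? ?; lra.
by move=> H; have [k] := filter_ex H; exists k.
Unshelve. all: by end_near. Qed.

End Putinar.

(** * Polynomials in a subset of the variables *)

Section SparsePolynomials.
Variables (R : realType) (n : nat) (I : {set 'I_n}).
Implicit Types p q : mpol R n.

Lemma supported_onP (a : mono n) :
  reflect (forall l, l \notin I -> a l = 0%N) (supported_on I a).
Proof.
apply: (iffP forallP) => H l; first by move=> lI; apply/eqP/(implyP (H l)).
by apply/implyP => lI; apply/eqP/H.
Qed.

Lemma supported_onD (a b : mono n) :
  supported_on I (a + b)%MM = supported_on I a && supported_on I b.
Proof.
apply/supported_onP/andP => [H|[/supported_onP Ha /supported_onP Hb] l lI].
  by split; apply/supported_onP => l /H; rewrite mnmDE; lia.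
by rewrite mnmDE Ha ?Hb.
Qed.

Lemma poly_inP p :
  reflect (forall a, a \in msupp p -> supported_on I a) (poly_in I p).
Proof. exact: allP. Qed.

Lemma poly_inC (c : R) : poly_in I (c%:MP : mpol R n).
Proof.
apply/poly_inP => a; rewrite msuppC; case: ifP => // _; rewrite inE => /eqP ->.
by apply/supported_onP => l _; rewrite mnm0E.
Qed.

Lemma poly_inX l : l \in I -> poly_in I ('X_l : mpol R n).
Proof.
move=> lI; apply/poly_inP => a; rewrite msuppX inE => /eqP ->.
by apply/supported_onP => i iI; rewrite mnm1E; case: eqP iI lI => // -> /negP.
Qed.

Lemma poly_inD p q : poly_in I p -> poly_in I q -> poly_in I (p + q).
Proof.
move=> /poly_inP Hp /poly_inP Hq; apply/poly_inP => a /msuppD_le.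
by rewrite mem_cat => /orP[/Hp|/Hq].
Qed.

Lemma poly_inM p q : poly_in I p -> poly_in I q -> poly_in I (p * q).
Proof.
move=> /poly_inP Hp /poly_inP Hq; apply/poly_inP => a /msuppM_le.
by move=> /allpairsP[[b c] /= [/Hp Hb /Hq Hc ->]]; rewrite supported_onD Hb Hc.
Qed.

Lemma poly_inZ (c : R) p : poly_in I p -> poly_in I (c *: p).
Proof. by rewrite -mul_mpolyC; apply: poly_inM; exact: poly_inC. Qed.

Lemma poly_inB p q : poly_in I p -> poly_in I q -> poly_in I (p - q).
Proof. by move=> Hp Hq; rewrite -scaleN1r; apply: poly_inD => //; exact: poly_inZ. Qed.

Lemma poly_in_sum (T : Type) (r : seq T) (P : pred T) (F : T -> mpol R n) :
  (forall i, P i -> poly_in I (F i)) -> poly_in I (\sum_(i <- r | P i) F i).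
Proof.
move=> HF; elim/big_rec: _ => [|i p Pi Hp]; first by rewrite -mpolyC0; exact: poly_inC.
by apply: poly_inD => //; exact: HF.
Qed.

Lemma eq_in_ev p (x y : 'rV[R]_n) : poly_in I p ->
  (forall l, l \in I -> x ord0 l = y ord0 l) -> ev p x = ev p y.
Proof.
move=> /poly_inP Hp xy; rewrite /ev !mevalE big_seq [RHS]big_seq.
apply: eq_bigr => a /Hp /supported_onP Ha; congr (_ * _); apply: eq_bigr => l _.
by have [/xy -> //|/Ha ->] := boolP (l \in I); rewrite !expr0.
Qed.

End SparsePolynomials.

Lemma sub_poly_in (R : realType) n (I I' : {set 'I_n}) (p : mpol R n) :
  I \subset I' -> poly_in I p -> poly_in I' p.
Proof.
move=> /fintype.subsetP II' /poly_inP Hp; apply/poly_inP => a /Hp /supported_onP Ha.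
by apply/supported_onP => l lI; apply: Ha; apply: contra lI; exact: II'.
Qed.

(** * Polynomial approximation of absolute values and minima *)

Section PolynomialMinimum.
Variables (R : realType) (n : nat) (S : {set 'I_n}) (c : R).

Lemma compact_lbound (T : topologicalType) (K : set T) (f : T -> R) :
  compact K -> (forall x, K x -> f @ x --> f x) -> exists C, forall x, K x -> C <= f x.
Proof.
move=> /compact_near_coveringP Kc fc.
have : \forall C \near -oo, K `<=` (fun x => C <= f x).
  apply: Kc => x Kx; near=> y C => /=.
  apply: (@le_trans _ _ (f x - 1)).
    by near: C; apply: nbhs_ninfty_le; exact: num_real.
  apply: ltW; near: y; apply: (cvgr_gt _ (fc x Kx)).
  by rewrite ltrBlDr ltrDl.
by move=> /filter_ex[C CK]; exists C.
Unshelve. all: by end_near. Qed.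

(** The iteration from the proof of the Stone-Weierstrass theorem: started at 0 it increases to the
    square root of [u ^+ 2]. *)
Let sqrt_step (u s : R) := s + 2^-1 * (u ^+ 2 - s ^+ 2).

(** With v = |u|, one step multiplies the error v - s by 1 - (v + s) / 2, which lies between 0 and 1
    - v / 2. *)
Let sqrt_approx (u : R) k : `|u| <= 1 ->
  0 <= iter k (sqrt_step u) 0 <= `|u| /\
  `|u| - iter k (sqrt_step u) 0 <= `|u| * (1 - `|u| / 2) ^+ k.
Proof.
rewrite /sqrt_step -real_normK ?num_real //; set v := `|u| => v1.
have v0 : 0 <= v by exact: normr_ge0.
elim: k => [|k [/andP[IH0 IH1] IH2]] /=; first by rewrite lexx v0 subr0 expr0 mulr1.
set s := iter k _ 0 in IH0 IH1 IH2 *.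
set w := _ ^+ k in IH2; rewrite [_ ^+ k.+1]exprS -/w.
have vs0 : 0 <= v - s by rewrite subr_ge0.
split.
  by apply/andP; split; nra.
have -> : v - (s + 2^-1 * (v ^+ 2 - s ^+ 2)) = (1 - (v + s) / 2) * (v - s) by field.
rewrite mulrCA; apply: (@le_trans _ _ ((1 - v / 2) * (v - s))); last first.
  by apply: ler_wpM2l => //; lra.
by apply: ler_wpM2r => //; lra.
Qed.

(** Applying the square root iteration to [p] itself, scaled into [-1, 1], introduces no variable
    outside [S]. *)
Lemma abs_poly_approx (p : mpol R n) (e : R) : poly_in S p -> 0 < e ->
  exists2 s, poly_in S s & forall x, box c x -> `|ev s x - `|ev p x| | <= e.
Proof.
move=> Sp e0.
have [C Cp] : exists C, forall x, box c x -> `|ev p x| <= C.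
  have [C1 C1p] := compact_lbound (@box_compact R n c) (fun x _ => @ev_continuous R n p x).
  have [C2 C2p] := compact_lbound (@box_compact R n c) (fun x _ => @ev_continuous R n (- p) x).
  exists (`|C1| + `|C2|) => x bx; rewrite ler_norml; have := C1p x bx; have := C2p x bx.
  rewrite /ev mevalN; set w := meval _ _ => H1 H2.
  have := ler_norm (- C1); have := ler_norm (- C2); rewrite !normrN => H3 H4.
  have := normr_ge0 C1; have := normr_ge0 C2 => H5 H6.
  by apply/andP; split; lra.
pose D := `|C| + 1; have D0 : 0 < D by rewrite ltr_wpDl.
pose step s := s + 2^-1 *: ((D^-1 *: p) ^+ 2 - s ^+ 2).
(* By [mul_pow1B_le] at |u| / 2, the error D |u| (1 - |u| / 2)^k is at most [D * 2 / k]. *)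
have [k k0 ke] : exists2 k : nat, 0 < k%:R :> R & D * 2 / k%:R <= e.
  exists (Num.bound (D * 2 / e)).+1 => //; rewrite ler_pdivrMr // [leRHS]mulrC -ler_pdivrMr //.
  apply: ltW; apply: (lt_le_trans (archi_boundP _)); last by rewrite ler_nat.
  by rewrite divr_ge0 ?mulr_ge0 // ltW.
exists (D *: iter k step 0).
  apply: poly_inZ; elim: k {k0 ke} => [|k IH] /=; first by rewrite -mpolyC0; exact: poly_inC.
  apply: poly_inD => //; apply: poly_inZ.
  by apply: poly_inB; apply: poly_inM => //; exact: poly_inZ.
move=> x bx; set u := ev p x / D.
have pD : ev p x = D * u by rewrite mulrC divfK // gt_eqF.
have evk : ev (iter k step 0) x = iter k (sqrt_step u) 0.
  elim: k {k0 ke} => [|k IH] /=; first by rewrite /ev meval0.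
  rewrite /sqrt_step -IH /ev mevalD mevalZ mevalB !rmorphXn /= mevalZ.
  by rewrite -/(ev p x) /u [_ / D]mulrC.
have u1 : `|u| <= 1.
  rewrite normrM normfV (gtr0_norm D0) ler_pdivrMr // mul1r.
  apply: (le_trans (Cp x bx)); apply: (le_trans (ler_norm _)).
  by rewrite lerDl.
have [/andP[s0 su] us] := sqrt_approx k u1.
rewrite {1}/ev mevalZ -/(ev _ x) evk pD normrM (gtr0_norm D0) -mulrBr normrM (gtr0_norm D0).
rewrite distrC [X in D * X]ger0_norm ?subr_ge0 //. apply: le_trans ke.
rewrite -mulrA ler_pM2l //; apply: (le_trans us).
rewrite ler_pdivlMr // mulrC.
have := @mul_pow1B_le R (`|u| / 2) k; rewrite divr_ge0 //= => H.
have {}H : k%:R * (`|u| / 2 * (1 - `|u| / 2) ^+ k) <= 1.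
  by apply: H; rewrite ler_pdivrMr // mul1r (le_trans u1) // ler1n.
by move: H; set w := _ ^+ k; lra.
Qed.

(** Induction through min(t, r) = (t + r - |t - r|) / 2, with half of the tolerance left for the
    tail. The two bounds together say that [t] is within [e] of the minimum. *)
Lemma min_poly_approx (p : mpol R n) (ps : seq (mpol R n)) (e : R) :
  poly_in S p -> all (poly_in S) ps -> 0 < e ->
  exists2 t, poly_in S t & forall x, box c x ->
    (forall r, r \in p :: ps -> ev t x <= ev r x + e) /\
    (exists2 r, r \in p :: ps & ev r x - e <= ev t x).
Proof.
move=> Sp; elim: ps e => [|r ps IH] e /= Sps e0.
  exists p => // x _; split; last by exists p; rewrite ?mem_head // gerBl ltW.
  by move=> r; rewrite inE => /eqP ->; rewrite lerDl ltW.
case/andP: Sps => Sr Sps.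
have e2 : 0 < e / 2 by rewrite divr_gt0.
have [t St tP] := IH _ Sps e2.
have [s Ss sP] := abs_poly_approx (poly_inB St Sr) e2.
exists (2^-1 *: (t + r - s)); first by apply/poly_inZ/poly_inB/Ss/poly_inD.
move=> x bx; have [t1 [r0 r0ps r0t]] := tP x bx; have := sP x bx.
have -> : ev (2^-1 *: (t + r - s)) x = 2^-1 * (ev t x + ev r x - ev s x).
  by rewrite /ev mevalZ mevalB mevalD.
rewrite [ev (t - r) x]mevalB -/(ev t x) -/(ev r x) ler_norml => /andP[s1 s2].
have tr1 := ler_norm (ev t x - ev r x).
have := ler_norm (- (ev t x - ev r x)); rewrite normrN => tr2.
split.
  move=> q; rewrite !inE orbCA => /orP[/eqP ->|qps]; first by lra.
  have := t1 q; rewrite inE => /(_ qps) H; lra.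
have [tr|tr] := lerP (ev t x) (ev r x).
  exists r0; first by move: r0ps; rewrite !inE orbCA => ->; rewrite orbT.
  by move: s1 s2; rewrite ler0_norm ?subr_le0 // => s1 s2; lra.
exists r; first by rewrite !inE eqxx orbT.
by move: s1 s2; rewrite gtr0_norm ?subr_gt0 // => s1 s2; lra.
Qed.

End PolynomialMinimum.

(** * Splitting a positive sum by a polynomial in the shared variables *)

Lemma near_fst (T U : topologicalType) (x : T) (z : U) (P : set T) :
  (\forall y \near x, P y) -> \forall w \near (x, z), P w.1.
Proof. by move=> Px; exists (P, setT) => [|w []//]; split => //; exact: filterT. Qed.

Lemma near_snd (T U : topologicalType) (x : T) (z : U) (P : set U) :
  (\forall y \near z, P y) -> \forall w \near (x, z), P w.2.
Proof. by move=> Pz; exists (setT, P) => [|w []//]; split => //; exact: filterT. Qed.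

Section Splitting.
Variables (R : realType) (n : nat) (S : {set 'I_n}) (c : R).
Variables (X Z : set 'rV[R]_n) (A B : 'rV[R]_n -> R).
Hypotheses (cX : compact X) (cZ : compact Z) (Xc : X `<=` box c)
  (Zc : Z `<=` box c).
Hypotheses (contA : forall x, X x -> A @ x --> A x)
  (contB : forall x, Z x -> B @ x --> B x).
Hypothesis AB0 : forall x z, X x -> Z z ->
  (forall l, l \in S -> x ord0 l = z ord0 l) -> 0 < A x + B z.

Let dist2 (z : 'rV[R]_n) : mpol R n :=
  \sum_(l in S) ('X_l - (z ord0 l)%:MP) ^+ 2.

Let dist2E z x : ev (dist2 z) x = \sum_(l in S) (x ord0 l - z ord0 l) ^+ 2.
Proof.
rewrite /ev rmorph_sum; apply: eq_bigr => l _.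
by rewrite rmorphXn /= mevalB mevalXU mevalC.
Qed.

Let dist2_ge0 z x : 0 <= ev (dist2 z) x.
Proof. by rewrite dist2E sumr_ge0 // => l _; rewrite sqr_ge0. Qed.

(** Where [x] and [z] agree on [S] the sum [A x + B z] is positive; elsewhere the penalty dominates;
    compactness of the product gives a common [M]. Taking [M^-1] as margin lets one parameter
    tending to infinity serve both cases. *)
Let penalty : exists2 M : R, 0 < M &
  forall x z, X x -> Z z -> M^-1 <= A x + B z + M * ev (dist2 z) x.
Proof.
have /compact_near_coveringP/near_covering_withinP cXZ := compact_setX cX cZ.
have : \forall M \near +oo, X `*` Z `<=`
    (fun w => M^-1 <= A w.1 + B w.2 + M * ev (dist2 w.2) w.1).
  apply: cXZ => -[x z] /= [Xx Zz].
  have [a0|/existsNP[l /not_implyP[lS /eqP xz]]] :=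
      pselect (forall l, l \in S -> x ord0 l = z ord0 l).
    have s0 := AB0 Xx Zz a0; set s := A x + B z in s0.
    near=> w M => /= _.
    have M0 : 0 < M by near: M; apply: nbhs_pinfty_gt; exact: num_real.
    have HA : A x - s / 4 < A w.1.
      near: w; apply: (@near_fst _ _ x z (fun y => A x - s / 4 < A y)).
      by apply: (cvgr_gt _ (contA Xx)); lra.
    have HB : B z - s / 4 < B w.2.
      near: w; apply: (@near_snd _ _ x z (fun y => B z - s / 4 < B y)).
      by apply: (cvgr_gt _ (contB Zz)); lra.
    have HM : M^-1 <= s / 2.
      have : 2 / s < M by near: M; apply: nbhs_pinfty_gt; exact: num_real.
      by rewrite ltr_pdivrMr // -[M^-1]mul1r ler_pdivrMr // => ?; lra.
    have := mulr_ge0 (ltW M0) (dist2_ge0 w.2 w.1).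
    by rewrite /s in HA HB HM *; lra.
  (* The two [l]-th coordinates are [4 * h] apart, so they stay more than [h] apart when each moves
     by less than [h]. *)
  pose h := `|x ord0 l - z ord0 l| / 4.
  have h0 : 0 < h by rewrite divr_gt0 // normr_gt0 subr_eq0.
  have near_coord (y : 'rV[R]_n) : nbhs y (fun t : 'rV[R]_n => `|y ord0 l - t ord0 l| < h).
    have /filterS := nbhsx_ballx y h h0; apply => t [_ yt]; exact: (yt ord0 l).
  near=> w M => /= _.
  have M1 : 1 < M by near: M; apply: nbhs_pinfty_gt; exact: num_real.
  have HA : A x - 1 < A w.1.
    near: w; apply: (@near_fst _ _ x z (fun y => A x - 1 < A y)).
    by apply: (cvgr_gt _ (contA Xx)); lra.
  have HB : B z - 1 < B w.2.
    near: w; apply: (@near_snd _ _ x z (fun y => B z - 1 < B y)).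
    by apply: (cvgr_gt _ (contB Zz)); lra.
  have Hx : `|x ord0 l - w.1 ord0 l| < h.
    near: w; apply: (@near_fst _ _ x z (fun y => `|x ord0 l - y ord0 l| < h)).
    exact: near_coord.
  have Hz : `|z ord0 l - w.2 ord0 l| < h.
    near: w; apply: (@near_snd _ _ x z (fun y => `|z ord0 l - y ord0 l| < h)).
    exact: near_coord.
  have Hd : h ^+ 2 <= ev (dist2 w.2) w.1.
    rewrite dist2E (bigD1 l) //= ler_wpDr //.
      by apply: sumr_ge0 => i _; rewrite sqr_ge0.
    rewrite -[leRHS]real_normK ?num_real // ler_sqr ?nnegrE ?normr_ge0 ?(ltW h0) //.
    have : `|x ord0 l - z ord0 l| <= `|x ord0 l - w.1 ord0 l| + `|w.1 ord0 l - w.2 ord0 l|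
         + `|z ord0 l - w.2 ord0 l|.
      rewrite (_ : x ord0 l - z ord0 l = (x ord0 l - w.1 ord0 l) + (w.1 ord0 l - w.2 ord0 l)
         - (z ord0 l - w.2 ord0 l)); last by ring.
      apply: (le_trans (ler_normB _ _)); rewrite lerD2r; exact: ler_normD.
    rewrite (_ : `|x ord0 l - z ord0 l| = h * 4); last by rewrite divfK.
    lra.
  (* The 3 pays for a loss of 1 in each of [A] and [B] and for [M^-1 < 1]. *)
  have HM : (3 - (A x + B z)) / h ^+ 2 < M.
    by near: M; apply: nbhs_pinfty_gt; exact: num_real.
  have h20 : 0 < h ^+ 2 by rewrite exprn_gt0.
  rewrite ltr_pdivrMr // in HM.
  have M0 : 0 < M by exact: lt_trans M1.
  have := ler_wpM2l (ltW M0) Hd.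
  have : M^-1 < 1 by rewrite invf_lt1.
  lra.
move=> H; have [M [M0 MP]] := filter_ex (filterI (nbhs_pinfty_gt (num_real (0 : R))) H).
by exists M => // x z Xx Zz; exact: (MP (x, z)).
Unshelve. all: by end_near. Qed.

(* [t] approximates the regularised infimum
   s |-> min_z (B z + M * |s - z|^2) - 2e over a finite net of points z of Z. *)
Lemma polynomial_splitting : exists2 t : mpol R n, poly_in S t &
  (forall x, X x -> 0 < A x + ev t x) /\ (forall z, Z z -> ev t z < B z).
Proof.
have [M M0 MP] := penalty.
pose e := M^-1 / 4; have e0 : 0 < e by rewrite divr_gt0 // invr_gt0.
(* On [O z0] the polynomial [r z0] defined below is less than [B - e], which leaves room for the
   error [e] of [min_poly_approx]. *)
pose O z0 := [set z | B z0 + M * ev (dist2 z0) z < B z + e].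
have OZ z : Z z -> nbhs z (O z).
  move=> Zz.
  have dzz : ev (dist2 z) z = 0.
    by rewrite dist2E big1 // => l _; rewrite subrr expr0n.
  have H1 : \forall y \near z, ev (dist2 z) y < M^-1 * (e / 2).
    apply: ev_near_lt; rewrite dzz; apply: mulr_gt0; first by rewrite invr_gt0.
    exact: divr_gt0.
  have H2 : \forall y \near z, B z - e / 2 < B y.
    by apply: (cvgr_gt _ (contB Zz)); rewrite ltrBlDr ltrDl; exact: divr_gt0.
  apply: filterS2 H1 H2 => y; rewrite -(ltr_pM2l M0) mulVKf ?gt_eqF //.
  rewrite /O /=; lra.
have := cZ; rewrite compact_cover => /(_ _ Z (fun z => (O z)^°)).
case=> [z _|z Zz|D DZ DP]; first exact: open_interior.
  by exists z => //; exact: OZ.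
have [C CA] := compact_lbound cX contA.
pose r z := (B z - 2 * e)%:MP + M *: dist2 z.
have evr z x : ev (r z) x = B z - 2 * e + M * ev (dist2 z) x.
  by rewrite /ev mevalD mevalC mevalZ.
have Sr z : poly_in S (r z).
  apply: poly_inD (poly_inC _ _) _; apply: poly_inZ; apply: poly_in_sum => l lS.
  by rewrite expr2; apply: poly_inM; apply: poly_inB (poly_inX _ lS) (poly_inC _ _).
(* The constant [2 * e - C] keeps the list nonempty even if [Z] is empty. It is harmless: where it
   is the active member, [A >= C] gives [A + t >= e]. *)
have [|t St tP] := @min_poly_approx R n S c (2 * e - C)%:MP [seq r z | z <- finmap.enum_fset D] e
  (poly_inC _ _) _ e0; first by apply/allP => _ /mapP[z _ ->].
exists t => //; split=> [x Xx|z Zz].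
  have [_ [q]] := tP x (Xc Xx); rewrite inE => /orP[/eqP ->|/mapP[z zD ->]].
    by rewrite /ev mevalC -/(ev t x); have := CA x Xx; lra.
  have Zz : Z z by have := DZ z zD; rewrite inE.
  have := MP x z Xx Zz; rewrite evr (_ : M^-1 = 4 * e); last first.
    by rewrite mulrC divfK.
  lra.
have [z0 /= z0D /interior_subset z0z] := DP z Zz.
have [tq _] := tP z (Zc Zz).
have := tq (r z0); rewrite inE map_f ?orbT // => /(_ isT); rewrite evr.
move: z0z; rewrite /O /=; lra.
Qed.

End Splitting.

(** * Riesz functionals and localizing matrices *)

Section RieszFunctional.
Variables (R : realType) (n : nat).
Implicit Types (y : mono n -> R) (f g h : mpol R n).

Lemma Lfun_wide y f k : (msize f <= k)%N ->
  Lfun y f = \sum_(a : 'X_{1..n < k}) f@_a * y a.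
Proof.
move=> fk; pose T : subFinType _ := 'X_{1..n < k}.
rewrite /Lfun (ssrcomplements.big_mksub T) ?msupp_uniq //=; last first.
  by move=> x /msize_mdeg_lt /leq_trans; apply.
by rewrite big_rmcond //= => a /memN_msupp_eq0 ->; rewrite mul0r.
Qed.

Lemma Lfun_is_linear y : linear_for *%R (Lfun y).
Proof.
move=> c f g; pose k := maxn (msize f) (msize g).
have fk : (msize f <= k)%N by exact: leq_maxl.
have gk : (msize g <= k)%N by exact: leq_maxr.
have fgk : (msize (c *: f + g) <= k)%N.
  apply: (leq_trans (msizeD_le _ _)); rewrite geq_max gk andbT.
  exact: leq_trans (msizeZ_le _ _) fk.
rewrite !(Lfun_wide _ (k := k)) // mulr_sumr -big_split /=.
by apply: eq_bigr => a _; rewrite mcoeffD mcoeffZ mulrDl mulrA.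
Qed.

HB.instance Definition _ y :=
  GRing.isLinear.Build R (mpol R n) R *%R (@Lfun R n y) (Lfun_is_linear y).

Lemma LfunX y a : Lfun y 'X_[a] = y a.
Proof. by rewrite /Lfun msuppX big_seq1 mcoeffX eqxx mul1r. Qed.

Lemma LfunXM y a g :
  Lfun y ('X_[a] * g) = \sum_(c <- msupp g) g@_c * y (c + a)%MM.
Proof.
rewrite {1}(mpolyE g) mulr_sumr raddf_sum /=; apply: eq_bigr => c _.
by rewrite -scalerAr linearZ /= -mpolyXD LfunX addmC.
Qed.

(** The quadratic form of the localizing matrix at the coefficient vector of [h]: the bridge from
    [psd_block] to positive multipliers. *)
Lemma Lfun_sqrM y g h k : (msize h <= k)%N ->
  Lfun y (h ^+ 2 * g) =
  \sum_(a : 'X_{1..n < k}) \sum_(b : 'X_{1..n < k})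
    h@_a * locent g y a b * h@_b.
Proof.
move=> hk; rewrite expr2 {1}(mpolywE hk) !mulr_suml raddf_sum /=.
apply: eq_bigr => a _; rewrite [X in _ * X * g](mpolywE hk) mulr_sumr mulr_suml raddf_sum /=.
apply: eq_bigr => b _; rewrite -scalerAl -scalerAr scalerA -scalerAl linearZ /=.
rewrite -mpolyXD LfunXM mulrAC; congr (_ * _ * _); apply: eq_bigr => c _.
by rewrite /madd addmA.
Qed.

(** On functionals, this is composition with the substitution x_l = 0 for l outside [I]; it makes
    squares of polynomials in all variables admissible. *)
Definition trunc (I : {set 'I_n}) y a : R := if supported_on I a then y a else 0.

Lemma Lfun_trunc I y f : poly_in I f -> Lfun (trunc I y) f = Lfun y f.
Proof.
move=> /poly_inP fI; rewrite /Lfun big_seq [RHS]big_seq; apply: eq_bigr => a /fI.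
by rewrite /trunc => ->.
Qed.

(** As [g] only involves [I], rows and columns outside the block vanish after truncation. Since
    [msize] is the degree plus one, [h] ranges over degree at most [k]. *)
Lemma psd_block_trunc I y g h k : poly_in I g ->
  psd_block k I (locent g y) -> (msize h <= k.+1)%N ->
  0 <= Lfun (trunc I y) (h ^+ 2 * g).
Proof.
move=> /poly_inP gI psd hk; rewrite (Lfun_sqrM _ _ hk).
have := psd (fun a => h@_a).
congr (0 <= _); rewrite [LHS]big_mkcond; apply: eq_bigr => a _.
have [aI|aI] := ifPn.
  rewrite [LHS]big_mkcond; apply: eq_bigr => b _.
  have [bI|bI] := ifPn.
    congr (_ * _ * _); rewrite /locent big_seq [RHS]big_seq; apply: eq_bigr => c /gI cI.
    by rewrite /trunc /madd !supported_onD cI aI bI.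
  rewrite /locent big1_seq ?mulr0 ?mul0r // => c _.
  by rewrite /trunc /madd !supported_onD (negbTE bI) andbF mulr0.
rewrite big1 // => b _.
rewrite /locent big1_seq ?mulr0 ?mul0r // => c _.
by rewrite /trunc /madd !supported_onD (negbTE aI) andbF mulr0.
Qed.

Lemma locent1 y a b : locent 1 y a b = y (madd a b).
Proof. by rewrite /locent msupp1 big_seq1 mcoeff1 eqxx mul1r /madd add0m. Qed.

Lemma eq_psd_block k I (A B : mono n -> mono n -> R) :
  (forall a b, A a b = B a b) -> psd_block k I A -> psd_block k I B.
Proof.
move=> AB psd v; have := psd v; congr (0 <= _); apply: eq_bigr => a _.
by apply: eq_bigr => b _; rewrite AB.
Qed.

Lemma psd_block_trunc1 I y h k :
  psd_block k I (fun a b => y (madd a b)) -> (msize h <= k.+1)%N ->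
  0 <= Lfun (trunc I y) (h ^+ 2).
Proof.
move=> psd hk; rewrite -[h ^+ 2]mulr1.
apply: (@psd_block_trunc I y 1 h k) => //; first by rewrite -mpolyC1 poly_inC.
by apply: eq_psd_block psd => a b; rewrite locent1.
Qed.

Definition ball_poly (I : {set 'I_n}) (M : R) : mpol R n :=
  M%:MP - \sum_(l in I) 'X_l ^+ 2.

(** * Moment bounds from a ball constraint *)

Section MomentBound.
Variables (I : {set 'I_n}) (M : R) (y : mono n -> R) (k : nat).
Hypotheses (M0 : 0 < M) (supp : forall a, ~~ supported_on I a -> y a = 0)
  (sq : forall h, (msize h <= k.+1)%N -> 0 <= Lfun y (h ^+ 2))
  (ballM : forall h, (msize h <= k)%N -> 0 <= Lfun y (h ^+ 2 * ball_poly I M)).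

Let sqX a : (mdeg a <= k)%N -> 0 <= y (a + a)%MM.
Proof.
move=> ak; have := @sq 'X_[a]; rewrite msizeX ltnS => /(_ ak).
by rewrite expr2 -mpolyXD LfunX.
Qed.

(** Testing the ball constraint on ['X_[b]] bounds the sum of the [y (2b + 2e_i)], [i] in [I], by
    [M * y (2b)]; the summands are nonnegative, so each variable removed costs a factor [M]. *)
Lemma moment_sqr_bound a : (mdeg a <= k)%N ->
  y (a + a)%MM <= M ^+ mdeg a * y 0%MM.
Proof.
move: {-1}(mdeg a) (erefl (mdeg a)) => d; elim: d a => [|d IH] a da ak.
  by move/eqP: da; rewrite mdeg_eq0 => /eqP ->; rewrite addm0 expr0 mul1r.
have y00 : 0 <= y 0%MM by rewrite -(addm0 0%MM); apply: sqX; rewrite mdeg0.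
have /existsP[l al] : [exists l, a l != 0%N].
  rewrite -negb_forall; apply/negP => /forallP a0; move: da; rewrite mdegE big1 //.
  by move=> l _; apply/eqP/a0.
have [lI|lI] := boolP (l \in I); last first.
  rewrite supp; first by rewrite mulr_ge0 // exprn_ge0 // ltW.
  rewrite supported_onD andbb; apply: contra al => /supported_onP /(_ l lI) ->.
  by [].
pose b := (a - U_(l))%MM; have ab : a = (b + U_(l))%MM by rewrite submK // lep1mP.
have db : mdeg b = d by move: da; rewrite ab mdegD mdeg1 addn1 => -[].
have bk : (mdeg b <= k)%N by rewrite db ltnW.
rewrite exprS -mulrA; apply: (@le_trans _ _ (M * y (b + b)%MM)); last first.
  by rewrite ler_pM2l //; apply: IH => //; exact: ltnW.
have Uk i : (mdeg (b + U_(i)) <= k)%N by rewrite mdegD mdeg1 addn1 db.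
have := @ballM 'X_[b]; rewrite msizeX db => /(_ ak).
have -> : Lfun y ('X_[b] ^+ 2 * ball_poly I M) =
    M * y (b + b)%MM - \sum_(i in I) y ((b + U_(i)) + (b + U_(i)))%MM.
  rewrite mulrBr raddfB /= [_ * _%:MP]mulrC mul_mpolyC linearZ /= expr2 -mpolyXD LfunX.
  congr (_ - _); rewrite mulr_sumr raddf_sum /=; apply: eq_bigr => i _.
  rewrite expr2 -!mpolyXD LfunX; congr (y _).
  by apply/mnmP => j; rewrite !mnmDE addnACA.
rewrite (bigD1 l) //= -ab subr_ge0; apply: le_trans; rewrite lerDl.
by apply: sumr_ge0 => i _; exact: sqX.
Qed.

(** Positivity on the squares of ['X_[a] + 1] and ['X_[a] - 1] gives 2 |y_a| <= y_(2a) + y_0. *)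
Lemma moment_bound a : (mdeg a <= k)%N ->
  `|y a| <= (1 + M ^+ mdeg a) * y 0%MM.
Proof.
move=> ak; have y00 : 0 <= y 0%MM by rewrite -(addm0 0%MM); apply: sqX; rewrite mdeg0.
have E (s : R) : Lfun y (('X_[a] + s%:MP) ^+ 2) =
    y (a + a)%MM + 2 * s * y a + s ^+ 2 * y 0%MM.
  have -> : ('X_[a] + s%:MP) ^+ 2 = 'X_[a + a] + (2 * s) *: 'X_[a] + (s ^+ 2) *: 'X_[0].
    rewrite mpolyXD mpolyX0 -!mul_mpolyC rmorphXn /= rmorphM /= rmorph_nat; ring.
  by rewrite !raddfD /= !linearZ /= !LfunX.
have sz (s : R) : (msize ('X_[a] + s%:MP) <= k.+1)%N.
  apply: (leq_trans (msizeD_le _ _)); rewrite geq_max msizeX ltnS ak msizeC.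
  by case: (s != 0).
have := sq (sz 1); have := sq (sz (-1)); rewrite !E => H1 H2.
have Ma0 : 0 <= M ^+ mdeg a * y 0%MM by rewrite mulr_ge0 // exprn_ge0 // ltW.
have := moment_sqr_bound ak; rewrite ler_norml => H3.
by apply/andP; split; rewrite mulrDl mul1r; lra.
Qed.

End MomentBound.

(* A coordinate outside I is harmless: y vanishes there, so multiplying by it
   gives 0. *)
Lemma box_multipliers (I : {set 'I_n}) (M c : R) y :
  0 < M -> 0 < c -> M <= c ^+ 2 ->
  (forall a, ~~ supported_on I a -> y a = 0) ->
  pos_mul (Lfun y) 1 -> pos_mul (Lfun y) (ball_poly I M) ->
  forall l, pos_mul (Lfun y) (c%:MP + 'X_l) /\ pos_mul (Lfun y) (c%:MP - 'X_l).
Proof.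
move=> M0 c0 Mc supp pos1 posM l.
have pos_of (s : R) : s ^+ 2 = 1 -> pos_mul (Lfun y) (c%:MP + s *: 'X_l).
  move=> s1; have [lI|lI] := boolP (l \in I).
    (* In the bracket every square except the first cancels against the ball polynomial, and [2 * c]
       times the left side remains. *)
    have -> : c%:MP + s *: 'X_l = (2 * c)^-1 *: ((c%:MP + s *: 'X_l) ^+ 2 +
        ((c ^+ 2 - M) *: 1 + (ball_poly I M +
           \sum_(i in I | i != l) 'X_i ^+ 2))) :> mpol R n.
      rewrite /ball_poly (bigD1 l) //=; set B := \sum_(_ in _ | _) _.
      have c20 : 2 * c != 0 by rewrite gt_eqF // mulr_gt0.
      apply: (scalerI c20); rewrite scalerA divff // scale1r.
      rewrite -!mul_mpolyC rmorphB rmorphXn /= rmorphM /= rmorph_nat.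
      have : (s%:MP : mpol R n) ^+ 2 = 1 by rewrite -rmorphXn s1.
      set t := s%:MP => t1.
      rewrite sqrrD exprMn t1; ring.
    apply: pos_mulZ; first by rewrite invr_ge0 mulr_ge0 // ltW.
    apply: pos_mulD; first exact: pos_mul_sq.
    apply: pos_mulD; first by apply: pos_mulZ => //; rewrite subr_ge0.
    apply: pos_mulD => //; elim/big_rec: _ => [h|i p _ Hp]; first by rewrite mulr0 raddf0.
    by apply: pos_mulD => //; exact: pos_mul_sq.
  have L0 f : Lfun y (f * 'X_l) = 0.
    rewrite mulrC LfunXM big1 // => a _; rewrite supp ?mulr0 //.
    rewrite supported_onD negb_and; apply/orP; right; apply/negP => /supported_onP.
    by move=> /(_ l lI); rewrite mnm1E eqxx.
  move=> h; rewrite mulrDr raddfD /= -scalerAr linearZ /= L0 mulr0 addr0.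
  rewrite mulrC mul_mpolyC linearZ /= mulr_ge0 ?(ltW c0) // -[h ^+ 2]mulr1.
  exact: pos1.
split; first by rewrite -['X_l]scale1r; apply: pos_of; rewrite expr1n.
by rewrite -scaleN1r; apply: pos_of; rewrite sqrrN expr1n.
Qed.

End RieszFunctional.

(** * Limits along ultrafilters *)

Lemma ultra_fmap (T T' : Type) (f : T -> T') (F : set_system T) :
  UltraFilter F -> UltraFilter (f @ F).
Proof.
move=> UF; split=> [|G GF sFG]; first exact: fmap_proper_filter.
rewrite predeqE => A; split; last exact: sFG.
move=> GA; have [//|FA] := in_ultra_setVsetC (f @^-1` A) UF.
have /filterI /(_ GA) : G (~` A) by exact: sFG.
by rewrite setICl => /filter_ex[].
Qed.

Lemma cvg_sumr (R : realType) (T I : Type) (F : set_system T) (r : seq I)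
    (P : pred I) (f : I -> T -> R) (l : I -> R) : Filter F ->
  (forall i, P i -> f i x @[x --> F] --> l i) ->
  \sum_(i <- r | P i) f i x @[x --> F] --> \sum_(i <- r | P i) l i.
Proof.
move=> FF fl; elim: r => [|i r IH].
  by rewrite big_nil; under eq_cvg do rewrite big_nil; exact: cvg_cst.
rewrite big_cons; under eq_cvg do rewrite big_cons.
by case: ifPn => // Pi; apply: cvgD IH; exact: fl.
Qed.

Section LimitFunctional.
Variables (R : realType) (n m : nat) (g : 'I_m -> mpol R n) (J : {set 'I_m}).

(** In the full space the constraints of one clique leave the other coordinates free; the box
    restores compactness. *)
Definition box_semialg (c : R) : set 'rV[R]_n :=
  [set x | box c x /\ forall j, j \in J -> 0 <= ev (g j) x].

Lemma box_semialg_compact c : compact (box_semialg c).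
Proof.
rewrite (_ : box_semialg c =
  box c `&` \bigcap_(j in [set` J]) (ev (g j) @^-1` [set x | 0 <= x])).
  apply: compact_closedI; first exact: box_compact.
  apply: closed_bigI => j _; apply: preimage_closed; last exact: closed_ge.
  by move=> x _; exact: ev_continuous.
by apply/seteqP; split => x [].
Qed.

Lemma hdeg_ball (I : {set 'I_n}) (M : R) : (hdeg (ball_poly I M) <= 1)%N.
Proof.
rewrite /hdeg; suff : (pdeg (ball_poly I M) <= 2)%N by case: pdeg => [|[|[]]].
apply/bigmax_leqP_seq => a /msize_mdeg_lt am _; rewrite -ltnS.
apply: (leq_trans am); apply: (leq_trans (msizeD_le _ _)).
rewrite geq_max msizeC (leq_trans (leq_b1 _)) //= msizeN.
apply: (leq_trans (msize_sum _ _ _)); apply/bigmax_leqP_seq => l _ _.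
by rewrite mpolyXn msizeX mdegMn mdeg1.
Qed.

Variables (I : {set 'I_n}) (M c : R) (q : mpol R n) (j0 : 'I_m).
Variables (y : nat -> mono n -> R) (U : set_system nat).
Hypotheses (M0 : 0 < M) (c0 : 0 < c) (Mc : M <= c ^+ 2) (j0J : j0 \in J)
  (gj0 : g j0 = ball_poly I M).
Hypotheses (UU : UltraFilter U) (Uoo : forall A, (\forall k \near \oo, A k) -> U A).
Hypotheses (supp : forall k a, ~~ supported_on I a -> y k a = 0)
  (sq : forall k h, (msize h <= k.+1)%N -> 0 <= Lfun (y k) (h ^+ 2))
  (loc : forall k j h, j \in J -> (msize h <= (k - hdeg (g j)).+1)%N ->
     0 <= Lfun (y k) (h ^+ 2 * g j))
  (one : forall k, Lfun (y k) q = 1).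
Hypothesis q0 : forall x, box_semialg c x -> 0 < ev q x.

Let UP : ProperFilter U := @ultra_proper _ U UU.

Let bound k a : (mdeg a <= k)%N -> `|y k a| <= (1 + M ^+ mdeg a) * y k 0%MM.
Proof.
apply: (@moment_bound _ _ I) => //; [exact: supp | exact: sq |].
move=> h hk; rewrite -gj0; apply: loc => //; apply: (leq_trans hk).
by rewrite gj0; have := hdeg_ball I M; lia.
Qed.

(** Zero mass would, by [bound], annihilate every moment occurring in [Lfun (y k) q], which equals
    1. *)
Let mass_gt0 k : (msize q <= k)%N -> 0 < y k 0%MM.
Proof.
move=> qk; have y00 : 0 <= y k 0%MM.
  have := @sq k 1; rewrite msize1 expr1n => /(_ isT).
  by rewrite -mpolyX0 LfunX.
rewrite lt_neqAle y00 andbT eq_sym; apply/negP => /eqP y0.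
have := one k; rewrite /Defs.Lfun big1_seq => [/eqP|a /= aq].
  by rewrite eq_sym oner_eq0.
have /bound : (mdeg a <= k)%N by rewrite (leq_trans _ qk) // ltnW // msize_mdeg_lt.
by rewrite y0 mulr0 normr_le0 => /eqP ->; rewrite mulr0.
Qed.

(** The constraint fixes the value at [q], not the mass. Dividing by the mass makes each moment
    bounded in [k], so that it converges along [U]. *)
Let w k a := y k a / y k 0%MM.

Let Lw k f : Lfun (w k) f = Lfun (y k) f / y k 0%MM.
Proof.
by rewrite /Defs.Lfun mulr_suml; apply: eq_bigr => a _; rewrite mulrA.
Qed.

Let w_cvg a : exists l : R, w k a @[k --> U] --> l.
Proof.
pose C := 1 + M ^+ mdeg a.
have := @segment_compact R (- C) C; rewrite compact_ultra => cC.
have [|l [_ wl]] := cC _ (ultra_fmap (fun k => w k a) UU); last by exists l.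
apply: Uoo; near=> k; rewrite /= in_itv /= -ler_norml /w normrM normfV.
have yk : 0 < y k 0%MM by apply: mass_gt0; near: k; exact: nbhs_infty_ge.
rewrite (gtr0_norm yk) ler_pdivrMr //; apply: bound.
by near: k; exact: nbhs_infty_ge.
Unshelve. all: by end_near. Qed.

Lemma Lfun_cvg (v : nat -> mono n -> R) z f :
  (forall a, v k a @[k --> U] --> z a) -> Lfun (v k) f @[k --> U] --> Lfun z f.
Proof.
move=> vz; apply: cvg_sumr => a _.
by apply: cvgM; [exact: cvg_cst | exact: vz].
Qed.

(** The limit [z] of the normalised moments has mass 1, so Putinar and [q > 0] give it a positive
    value [s] at [q]; dividing by [s] undoes the normalisation. *)
Lemma limit_functional : exists z : mono n -> R,
  [/\ forall f, Lfun (y k) f @[k --> U] --> Lfun z f,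
      pos_mul (Lfun z) 1,
      forall j, j \in J -> pos_mul (Lfun z) (g j) &
      forall l, pos_mul (Lfun z) (c%:MP + 'X_l) /\ pos_mul (Lfun z) (c%:MP - 'X_l)].
Proof.
have [z wz] := choice w_cvg.
have Lwz f := @Lfun_cvg w z f wz.
have winv k f : (msize q <= k)%N -> 0 <= Lfun (y k) f -> 0 <= Lfun (w k) f.
  by move=> /mass_gt0 yk Lf; rewrite Lw divr_ge0 // ltW.
have posg j : j \in J -> pos_mul (Lfun z) (g j).
  move=> jJ h; apply: (cvgr_to_ge (Lwz _)); apply: Uoo; near=> k.
  apply: winv; first by near: k; exact: nbhs_infty_ge.
  apply: loc => //; have : (msize h + hdeg (g j) <= k)%N by near: k; exact: nbhs_infty_ge.
  lia.
have pos1 : pos_mul (Lfun z) 1.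
  move=> h; apply: (cvgr_to_ge (Lwz _)); apply: Uoo; near=> k.
  rewrite mulr1; apply: winv; first by near: k; exact: nbhs_infty_ge.
  by apply: sq; apply: leqW; near: k; exact: nbhs_infty_ge.
have zsupp a : ~~ supported_on I a -> z a = 0.
  move=> aI; apply: (@cvg_unique R^o _ (w k a @[k --> U])); [exact: Rhausdorff|exact: wz|].
  by apply: cvg_near_cst; near=> k; rewrite /w (@supp k a aI) mul0r.
have posM : pos_mul (Lfun z) (ball_poly I M) by rewrite -gj0; exact: posg.
have mult := box_multipliers M0 c0 Mc zsupp pos1 posM.
have z1 : z 0%MM = 1.
  apply: (@cvg_unique R^o _ (w k 0%MM @[k --> U])); [exact: Rhausdorff|exact: wz|].
  apply: cvg_near_cst; apply: Uoo; near=> k; rewrite /w divff // gt_eqF //.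
  by apply: mass_gt0; near: k; exact: nbhs_infty_ge.
have [d d0 qd] := compact_min_pos (@box_semialg_compact c)
  (fun x _ => @ev_continuous R n q x) q0.
(* Half of the minimum [d] makes [q - d / 2] strictly positive, as [putinar] requires. *)
have Lq : d / 2 <= Lfun z q.
  have : 0 <= Lfun z (q - (d / 2)%:MP).
    apply: (@putinar R n m _ c g J c0 pos1) => [l|l||x bx gx].
    - by case: (mult l).
    - by case: (mult l).
    - exact: posg.
    have := qd x (conj bx gx); rewrite /ev mevalB mevalC; lra.
  rewrite raddfB /= -[(d / 2)%:MP]mulr1 mul_mpolyC linearZ /= -mpolyX0 LfunX z1 mulr1.
  by rewrite subr_ge0.
set s := Lfun z q in Lq; have s0 : 0 < s by apply: lt_le_trans Lq; rewrite divr_gt0.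
pose z' a := z a / s.
have Lz' f : Lfun z' f = s^-1 * Lfun z f.
  rewrite /Defs.Lfun mulr_sumr; apply: eq_bigr => a _; rewrite /z'; ring.
have pos' f : pos_mul (Lfun z) f -> pos_mul (Lfun z') f.
  move=> Pf h; rewrite /= Lz'; apply: mulr_ge0 (Pf h); by rewrite invr_ge0 ltW.
exists z'; split; last first.
- by move=> l; case: (mult l) => H1 H2; split; exact: pos'.
- by move=> j jJ; apply/pos'/posg.
- exact: pos'.
move=> f; rewrite Lz' mulrC.
(* This quotient is eventually [Lfun (y k) f], because the masses cancel and [Lfun (y k) q = 1]. *)
have : Lfun (w k) f * (Lfun (w k) q)^-1 @[k --> U] --> Lfun z f * s^-1.
  by apply: cvgM; [exact: Lwz | apply: cvgV; [rewrite gt_eqF | exact: Lwz]].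
apply: cvg_trans; apply: near_eq_cvg; apply: Uoo; near=> k.
rewrite /= !Lw one mul1r invrK mulfVK // gt_eqF //.
by apply: mass_gt0; near: k; exact: nbhs_infty_ge.
Unshelve. all: by end_near. Qed.

End LimitFunctional.

(** * The lower bound for compatible functionals, clique by clique *)

Section SparseLowerBound.
Variables (R : realType) (n m N : nat) (p q : 'I_N.+1 -> mpol R n)
  (g : 'I_m -> mpol R n) (I : 'I_N.+1 -> {set 'I_n}) (J : 'I_N.+1 -> {set 'I_m})
  (c b : R) (L : 'I_N.+1 -> {scalar mpol R n}).
Hypotheses (c0 : 0 < c) (pI : forall i, poly_in (I i) (p i))
  (qI : forall i, poly_in (I i) (q i))
  (gI : forall i j, j \in J i -> poly_in (I i) (g j)).
Local Notation K i := (box_semialg g (J i) c).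
Hypotheses (q0 : forall i x, K i x -> 0 < ev (q i) x)
  (pos1 : forall i, pos_mul (L i) 1)
  (posD : forall i l, pos_mul (L i) (c%:MP + 'X_l))
  (posB : forall i l, pos_mul (L i) (c%:MP - 'X_l))
  (posg : forall i j, j \in J i -> pos_mul (L i) (g j))
  (one : forall i, L i (q i) = 1)
  (link : forall i j a, supported_on (I i :&: I j)%SET a ->
     L i ('X_[a] * q i) = L j ('X_[a] * q j))
  (RIP : forall i : 'I_N.+1, (1 <= i)%N -> exists2 k : 'I_N.+1, (k < i)%N &
     (I i :&: \bigcup_(j : 'I_N.+1 | (j < i)%N) I j \subset I k)%SET)
  (bF : forall x, (forall i, K i x) -> b < \sum_i ev (p i) x / ev (q i) x).

Let F i x := ev (p i) x / ev (q i) x - b / N.+1%:R.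

Let F_continuous i x : K i x -> F i @ x --> F i x.
Proof.
move=> Kx.
apply: (@continuousB _ R 'rV[R]_n (fun y => ev (p i) y / ev (q i) y) (cst (b / N.+1%:R))).
  apply: (@continuousM R 'rV[R]_n (ev (p i)) (fun y => (ev (q i) y)^-1)).
    exact: ev_continuous.
  by apply: (@continuousV R 'rV[R]_n); [rewrite gt_eqF // q0 | exact: ev_continuous].
exact: cst_continuous.
Qed.

Let eq_F i (x y : 'rV[R]_n) : (forall l, l \in I i -> x ord0 l = y ord0 l) -> F i x = F i y.
Proof. by move=> xy; rewrite /F !(eq_in_ev _ xy). Qed.

Let link_poly i k t : poly_in (I i :&: I k)%SET t -> L i (q i * t) = L k (q k * t).
Proof.
move=> /poly_inP tS; rewrite (mpolyE t) !mulr_sumr !raddf_sum /= big_seq [RHS]big_seq.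
apply: eq_bigr => a /tS aS; rewrite -!scalerAr !linearZ /=; congr (_ * _).
by rewrite ![q _ * _]mulrC; exact: link.
Qed.

(* The corrections obtained after splitting off the cliques of index > r. *)
Let split_off r (T : 'I_N.+1 -> mpol R n) :=
  [/\ forall i, poly_in (I i) (T i), \sum_i L i (q i * T i) = 0,
      forall (i : 'I_N.+1) x, (r < i)%N -> K i x -> 0 < F i x + ev (T i) x &
      forall x, (forall i : 'I_N.+1, (i <= r)%N -> K i x) ->
        0 < \sum_(i < N.+1 | (i <= r)%N) (F i x + ev (T i) x)].

(** [polynomial_splitting] separates clique [r.+1] from the earlier ones by a polynomial [t] in
    their overlap, which is moved to a clique [k] containing that overlap. *)
Let split_off_step r T : (r < N)%N -> split_off r.+1 T -> exists T', split_off r T'.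
Proof.
move=> rN [TI Tsum Tout Tin].
have rN1 : (r.+1 < N.+1)%N by [].
pose i := Ordinal rN1; have [k ki Sk] := RIP (i := i) isT.
set S := (I i :&: _)%SET in Sk.
have ik : i == k = false by apply/eqP => ikE; move: ki; rewrite -ikE ltnn.
pose A x := \sum_(j < N.+1 | (j <= r)%N) (F j x + ev (T j) x).
pose B x := F i x + ev (T i) x.
pose X := box_semialg g (\bigcup_(j < N.+1 | (j <= r)%N) J j)%SET c.
have XK x : X x <-> (forall j : 'I_N.+1, (j <= r)%N -> K j x).
  split=> [[bx gx] j jr|Kx].
    by split=> // l lJ; apply: gx; apply/bigcupP; exists j.
  split; first by case: (Kx ord0 isT).
  by move=> l /bigcupP[j jr lJ]; case: (Kx j jr) => _; apply.
have contFT j x : K j x -> (fun x => F j x + ev (T j) x) @ x --> F j x + ev (T j) x.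
  move=> Kx; apply: (@continuousD _ R 'rV[R]_n (F j) (ev (T j))).
    exact: F_continuous.
  exact: ev_continuous.
have [||||||x z Xx Kz xz|t tS [tX tZ]] :=
  @polynomial_splitting R n S c X (K i) A B.
- exact: box_semialg_compact.
- exact: box_semialg_compact.
- by move=> x [].
- by move=> x [].
- by move=> x /XK Xx; apply: (@cvg_sumr R 'rV[R]_n _ (nbhs x)) => j jr; apply: contFT; exact: Xx.
- by move=> x; exact: contFT.
(* Points that agree on the overlap are glued to one point satisfying the constraints of all cliques
   up to [r.+1]. *)
- pose w : 'rV[R]_n := \row_l if l \in I i then z ord0 l else x ord0 l.
  have wz l : l \in I i -> w ord0 l = z ord0 l by move=> lI; rewrite mxE lI.
  have wx (j : 'I_N.+1) l : (j <= r)%N -> l \in I j -> w ord0 l = x ord0 l.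
    move=> jr lI; rewrite mxE; case: ifP => // lIi; apply/esym/xz.
    by rewrite inE lIi; apply/bigcupP; exists j.
  have bw : box c w.
    move=> l; rewrite mxE; case: ifP => _; first by case: Kz => /(_ l).
    by case: Xx => /(_ l).
  have Kw (j : 'I_N.+1) : (j <= r.+1)%N -> K j w.
    rewrite leq_eqVlt => /orP[/eqP jE|jr].
      have -> : j = i by exact: val_inj.
      split=> // l lJ; rewrite (eq_in_ev (gI lJ) wz); by case: Kz => _; apply.
    split=> // l lJ; rewrite (eq_in_ev (gI lJ) (fun l => @wx j l jr)).
    by have /XK /(_ j jr) [_] := Xx; apply.
  have := Tin w Kw; rewrite (bigD1 i) //= addrC.
  have -> : F i w + ev (T i) w = B z by rewrite (eq_F wz) (eq_in_ev (TI i) wz).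
  congr (0 < _ + _); rewrite /A; apply: eq_big => [j|j /andP[jr ji]].
    by rewrite [in RHS]leq_eqVlt -(inj_eq val_inj) /=; lia.
  have jr' : (j <= r)%N by move: jr ji; rewrite leq_eqVlt -(inj_eq val_inj) /=; lia.
  have E := fun l => @wx j l jr'.
  by rewrite (eq_F E) (eq_in_ev (TI j) E).
have Si : S \subset I i by exact: subsetIl.
(* [t] is added to [T k] and subtracted from [T i]; compatibility on the overlap keeps the weighted
   sum zero. *)
pose s j : R := (j == k)%:R - (j == i)%:R.
have evT x j : ev (T j + s j *: t) x = ev (T j) x + s j * ev t x.
  by rewrite /ev mevalD mevalZ.
exists (fun j => T j + s j *: t); split.
- move=> j; apply: poly_inD => //; rewrite /s.
  have [->|jk] := eqVneq j k; first by apply/poly_inZ/(sub_poly_in Sk).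
  have [->|ji] := eqVneq j i; first by apply/poly_inZ/(sub_poly_in Si).
  by rewrite subrr scale0r -mpolyC0; exact: poly_inC.
- transitivity (\sum_j L j (q j * T j) +
     (\sum_j (j == k)%:R * L j (q j * t) - \sum_j (j == i)%:R * L j (q j * t))).
    rewrite -sumrB -big_split; apply: eq_bigr => j _.
    by rewrite mulrDr -scalerAr raddfD /= linearZ /= mulrBl.
  have pick1 (l : 'I_N.+1) : \sum_j (j == l)%:R * L j (q j * t) = L l (q l * t).
    rewrite (bigD1 l) //= eqxx mul1r big1 ?addr0 // => j /negbTE ->.
    by rewrite mul0r.
  rewrite !pick1 Tsum add0r (@link_poly k i) ?subrr //.
  by apply: sub_poly_in tS; apply/fintype.subsetP => l lS;
    rewrite inE (fintype.subsetP Sk) // (fintype.subsetP Si).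
- move=> j x rj Kx; rewrite evT /s.
  have -> : j == k = false by apply/eqP => jk; move: ki rj; rewrite jk /=; lia.
  have [jE|ji] := eqVneq j i.
    by rewrite jE in Kx *; rewrite sub0r mulN1r addrA subr_gt0; exact: tZ.
  rewrite subrr mul0r addr0; apply: Tout => //.
  by rewrite ltn_neqAle eq_sym rj andbT -[r.+1]/(val i) (inj_eq val_inj).
- move=> x Kx; rewrite [ltRHS](_ : _ = A x + ev t x); first by apply/tX/XK.
  transitivity (A x + \sum_(j < N.+1 | (j <= r)%N) s j * ev t x).
    by rewrite -big_split; apply: eq_bigr => j _; rewrite evT addrA.
  congr (_ + _); rewrite (bigD1 k) //= /s eqxx eq_sym ik subr0 mul1r big1 ?addr0 //.
  move=> j /andP[jr /negbTE ->]; rewrite [_ == i](_ : _ = false) ?subrr ?mul0r //.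
  by apply/eqP => jE; move: jr; rewrite jE ltnn.
Qed.

Theorem sparse_lower_bound : b <= \sum_i L i (p i).
Proof.
have split0 r : (r <= N)%N -> exists T, split_off (N - r) T.
  elim: r => [|r IH] rN.
    exists (fun=> 0); rewrite subn0; split=> [i||i x iN|x Kx].
    - by rewrite -mpolyC0; exact: poly_inC.
    - by rewrite big1 // => i _; rewrite mulr0 raddf0.
    - by have := ltn_ord i; rewrite ltnS leqNgt iN.
    have Kx' i : K i x by apply: Kx; rewrite -ltnS.
    rewrite (eq_bigl xpredT) => [|i]; last by rewrite -ltnS ltn_ord.
    rewrite big_split /= sumrB [X in _ + X]big1 ?addr0 => [|i _]; last exact: meval0.
    rewrite sumr_const card_ord -[_ *+ _]mulr_natr divfK ?pnatr_eq0 // subr_gt0.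
    exact: bF.
  have [T HT] := IH (ltnW rN).
  apply: (@split_off_step _ T); first by lia.
  by rewrite subnSK.
have [T [TI Tsum Tout Tin]] := split0 N (leqnn N); rewrite subnn in Tout Tin.
(* For the first clique the remaining sum [Tin] has a single term. *)
have FT i x : K i x -> 0 < F i x + ev (T i) x.
  move=> Kx; have [i0|] := posnP i; last by move=> i0; exact: Tout.
  have iE (j : 'I_N.+1) : (j <= 0)%N = (j == i).
    by rewrite -(inj_eq val_inj) /= i0 leqn0.
  have := Tin x; rewrite (eq_bigl _ _ iE) big_pred1_eq; apply => j.
  by rewrite iE => /eqP ->.
(* The argument of [L i] evaluates to q_i (F_i + T_i), positive on [K i]. *)
have Lpos i : 0 <= L i (p i - (b / N.+1%:R) *: q i + q i * T i).
  apply: (@putinar R n m (L i) c g (J i) c0) => //; first exact: posg.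
  move=> x bx gx; have Kx : K i x by [].
  have := mulr_gt0 (q0 Kx) (FT i x Kx).
  congr (0 < _); rewrite [in RHS]/ev mevalD mevalB mevalZ mevalM -!/(ev _ x) /F.
  have qn : ev (q i) x != 0 by rewrite gt_eqF // q0.
  have Nn : N.+1%:R != 0 :> R by rewrite pnatr_eq0.
  by move: N.+1%:R Nn => s Nn; field; rewrite ?Nn ?qn.
have : 0 <= \sum_i L i (p i - (b / N.+1%:R) *: q i + q i * T i) by exact: sumr_ge0.
rewrite (eq_bigr (fun i => L i (p i) - b / N.+1%:R + L i (q i * T i))) => [|i _].
  rewrite big_split /= Tsum addr0 sumrB sumr_const card_ord -[_ *+ _]mulr_natr.
  by rewrite divfK ?pnatr_eq0 // subr_ge0.
by rewrite raddfD /= raddfB /= linearZ /= one mulr1.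
Qed.

End SparseLowerBound.

(** * Sign symmetries and masking *)

Section SignSymmetry.
Variables (R : realType) (n : nat) (A : seq (mono n)).

Lemma rdotD (r : {ffun 'I_n -> bool}) (a b : mono n) :
  rdot r (madd a b) = (rdot r a + rdot r b)%N.
Proof.
rewrite /rdot -big_split; apply: eq_bigr => l _.
by rewrite /mexp /madd mnmDE mulnDr.
Qed.

(** Listing the sign vectors allows masking by one vector at a time. *)
Lemma in_AbarE a :
  in_Abar A a = all (fun r => ~~ odd (rdot r a)) [seq r <- enum {ffun 'I_n -> bool} | in_Rset A r].
Proof.
apply/forallP/allP => [H r|H r].
  by rewrite mem_filter => /andP[rR _]; exact: (implyP (H r)).
by apply/implyP => rR; apply: H; rewrite mem_filter rR mem_enum.
Qed.

Lemma mem_in_Abar a : a \in A -> in_Abar A a.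
Proof. by move=> aA; apply/forallP => r; apply/implyP => /allP; apply. Qed.

(** Parities add, so multiplying by a polynomial with support in Abar commutes with masking. *)
Lemma in_AbarDl a b : in_Abar A a -> in_Abar A (madd a b) = in_Abar A b.
Proof.
move=> /forallP Ha; apply: eq_forallb => r; have := Ha r.
by rewrite rdotD oddD; case: (in_Rset A r) => //= /negbTE ->.
Qed.

(* Masking by one sign vector averages the form over the flip
   v_a -> (-1)^(r.a) v_a. *)
Lemma psd_block_mask s (I : {set 'I_n}) (B : mono n -> mono n -> R) :
  psd_block s I B ->
  psd_block s I (fun a b => if in_Abar A (madd a b) then B a b else 0).
Proof.
move=> PB; suff PBr rs : psd_block s I (fun a b =>
    if all (fun r => ~~ odd (rdot r (madd a b))) rs then B a b else 0).
  by apply: eq_psd_block (PBr _) => a b; rewrite in_AbarE.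
elim: rs => [|r rs IH] //= v.
set C := fun a b => if all _ rs then B a b else 0 in IH.
pose sg (a : mono n) : R := (-1) ^+ odd (rdot r a).
have := addr_ge0 (IH v) (IH (fun a => sg a * v a)).
rewrite -(@pmulr_rge0 R 2 (\sum_(a : 'X_{1..n < s.+1} | _) _)) //.
congr (0 <= _); rewrite mulr_sumr -big_split; apply: eq_bigr => a _.
rewrite mulr_sumr -big_split; apply: eq_bigr => b _ /=.
rewrite /C /sg rdotD oddD; case: (all _ rs); rewrite ?andbF ?andbT; last by ring.
by case: (odd (rdot r a)); case: (odd (rdot r b)) => /=; ring.
Qed.

End SignSymmetry.

(** * Monotonicity of the blocks in the order *)

Section Widening.
Variables (R : realType) (n : nat).

Lemma big_bmultinom_widen k1 k2 (P : pred (mono n)) (F : mono n -> R) :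
  (k1 <= k2)%N -> (forall a, (k1 < mdeg a)%N -> F a = 0) ->
  \sum_(a : 'X_{1..n < k2.+1} | P a) F a = \sum_(a : 'X_{1..n < k1.+1} | P a) F a.
Proof.
move=> k12 F0; have k12' : (k1.+1 <= k2.+1)%N by [].
pose h (a : 'X_{1..n < k1.+1}) : 'X_{1..n < k2.+1} :=
  BMultinom (leq_trans (bmdeg a) k12').
pose h' (a : 'X_{1..n < k2.+1}) : 'X_{1..n < k1.+1} := insubd bm0 (val a).
rewrite (bigID (fun a : 'X_{1..n < k2.+1} => (mdeg a < k1.+1)%N)) /= addrC big1; last first.
  by move=> a /andP[_]; rewrite -leqNgt => /F0.
rewrite add0r (reindex_onto h h') /=; last first.
  by move=> a /andP[_ ak]; apply: val_inj; rewrite /= insubdK.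
apply: eq_bigl => a; rewrite bmdeg andbT.
by rewrite (_ : h' (h a) = a) ?eqxx ?andbT //; exact: valKd.
Qed.

(** A smaller block is a principal submatrix: test vectors are padded with zeros. *)
Lemma psd_block_le k1 k2 (I : {set 'I_n}) (B : mono n -> mono n -> R) :
  (k1 <= k2)%N -> psd_block k2 I B -> psd_block k1 I B.
Proof.
move=> k12 PB v; pose v' (a : mono n) : R := oapp v 0 (insub a).
have v'0 a : (k1 < mdeg a)%N -> v' a = 0.
  by move=> ak; rewrite /v' insubF // ltnS leqNgt ak.
have v'E (a : 'X_{1..n < k1.+1}) : v' a = v a by rewrite /v' valK.
have := PB (fun a => v' a); congr (0 <= _).
rewrite (@big_bmultinom_widen k1 k2 (supported_on I) (fun a =>
  \sum_(b : 'X_{1..n < k2.+1} | supported_on I b) v' a * B a b * v' b)) //; last first.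
  by move=> a /v'0 ->; rewrite big1 // => b _; rewrite !mul0r.
apply: eq_bigr => a _; rewrite (@big_bmultinom_widen k1 k2 (supported_on I) (fun b =>
  v' a * B a b * v' b)) //; last by move=> b /v'0 ->; rewrite mulr0.
by apply: eq_bigr => b _; rewrite !v'E.
Qed.

End Widening.

(** * Comparison of the two relaxations with each other and with the optimum *)

Section Relaxations.
Variables (R : realType) (n m N : nat) (p q : 'I_N -> mpol R n)
  (g : 'I_m -> mpol R n) (I : 'I_N -> {set 'I_n}) (J : 'I_N -> {set 'I_m}).
Local Notation A := (Aseq p q g).

Lemma feas_c_le k1 k2 y : (k1 <= k2)%N ->
  feas_c p q g I J k2 y -> feas_c p q g I J k1 y.
Proof.
move=> k12 [H1 H2 H3 H4]; split=> //.
- by move=> i; exact: psd_block_le (H1 i).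
- by move=> i j jJ; apply: psd_block_le (H2 i j jJ); exact: leq_sub2r.
- move=> i j ij I0 a da aS; apply: H4 => //; apply: (leq_trans da).
  by apply: leq_sub2r; rewrite leq_mul2l.
Qed.

Lemma feas_cs_of_c k y : feas_c p q g I J k y -> feas_cs p q g I J k y.
Proof.
move=> [H1 H2 H3 H4]; split=> //.
- by move=> i; exact: psd_block_mask (H1 i).
- by move=> i j jJ; exact: psd_block_mask (H2 i j jJ).
- by move=> i j ij I0 a da aS _; exact: H4.
Qed.

Let msupp_p i a : a \in msupp (p i) -> in_Abar A a.
Proof.
move=> ap; apply: mem_in_Abar; apply/flattenP.
exists (msupp (p i) ++ msupp (q i)); last by rewrite mem_cat ap.
by rewrite mem_cat; apply/orP; left; apply/mapP; exists i => //; rewrite mem_enum.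
Qed.

Let msupp_q i a : a \in msupp (q i) -> in_Abar A a.
Proof.
move=> ap; apply: mem_in_Abar; apply/flattenP.
exists (msupp (p i) ++ msupp (q i)); last by rewrite mem_cat ap orbT.
by rewrite mem_cat; apply/orP; left; apply/mapP; exists i => //; rewrite mem_enum.
Qed.

Let msupp_g j a : a \in msupp (g j) -> in_Abar A a.
Proof.
move=> ap; apply: mem_in_Abar; apply/flattenP; exists (msupp (g j)) => //.
by rewrite mem_cat; apply/orP; right; apply/mapP; exists j => //; rewrite mem_enum.
Qed.

Definition mask (y : 'I_N -> mono n -> R) i a : R := if in_Abar A a then y i a else 0.

Let Lfun_mask y i f : (forall a, a \in msupp f -> in_Abar A a) ->
  Lfun (mask y i) f = Lfun (y i) f.
Proof.
move=> fA; rewrite /Defs.Lfun big_seq [RHS]big_seq; apply: eq_bigr => a /fA.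
by rewrite /mask => ->.
Qed.

(** By [in_AbarDl], each localizing entry and each linking value is either unchanged by the mask or
    becomes 0; outside Abar both sides of a linking equality vanish. *)
Lemma feas_c_of_cs k y : feas_cs p q g I J k y -> feas_c p q g I J k (mask y).
Proof.
move=> [H1 H2 H3 H4]; split.
- exact: H1.
- move=> i j jJ; apply: eq_psd_block (H2 i j jJ) => a b.
  rewrite /locent; case: ifP => abA.
    rewrite big_seq [RHS]big_seq; apply: eq_bigr => c cg.
    rewrite /mask (_ : madd (madd c a) b = madd c (madd a b)).
      by rewrite (in_AbarDl _ (msupp_g cg)) abA.
    by rewrite /madd addmA.
  rewrite big1_seq // => c /= cg; rewrite /mask (_ : madd (madd c a) b = madd c (madd a b)).
    by rewrite (in_AbarDl _ (msupp_g cg)) abA mulr0.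
  by rewrite /madd addmA.
- by move=> i; rewrite Lfun_mask // => a; exact: msupp_q.
have LX i a : Lfun (mask y i) (xmon R a * q i) =
    if in_Abar A a then Lfun (y i) (xmon R a * q i) else 0.
  rewrite /xmon !LfunXM; case: ifP => aA; last rewrite big1_seq // => c /= cq.
    rewrite big_seq [RHS]big_seq; apply: eq_bigr => c cq.
    by rewrite /mask -/(madd c a) (in_AbarDl _ (msupp_q cq)) aA.
  by rewrite /mask -/(madd c a) (in_AbarDl _ (msupp_q cq)) aA mulr0.
move=> i j ij I0 a da aS; rewrite !LX; case: ifP => // aA.
exact: H4.
Qed.

Lemma rho_cs_eq k : rho_cs p q g I J k = rho_c p q g I J k.
Proof.
apply/eqP; rewrite eq_le; apply/andP; split; apply: le_ereal_inf => _ [y Hy <-].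
  by exists y => //; exact: feas_cs_of_c.
exists (mask y); first exact: feas_c_of_cs.
by congr (_%:E); apply: eq_bigr => i _; rewrite Lfun_mask // => a; exact: msupp_p.
Qed.

Lemma rho_c_le k1 k2 : (k1 <= k2)%N -> (rho_c p q g I J k1 <= rho_c p q g I J k2)%E.
Proof.
by move=> k12; apply: le_ereal_inf => _ [y Hy <-]; exists y => //; exact: feas_c_le Hy.
Qed.

(** A point [x] of the feasible set gives, for each [i], the moments of the Dirac measure at [x]
    divided by q_i(x); the resulting matrices are nonnegative multiples of one of rank one. *)
Lemma rho_c_le_rho k : (forall i x, Kset g x -> 0 < ev (q i) x) ->
  (rho_c p q g I J k <= rho p q g)%E.
Proof.
move=> q0; apply: le_ereal_inf => _ [x Kx <-].
pose xm (a : mono n) : R := \prod_(l < n) x ord0 l ^+ a l.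
have xmD a b : xm (madd a b) = xm a * xm b.
  by rewrite /xm -big_split; apply: eq_bigr => l _; rewrite /madd mnmDE exprD.
pose y (i : 'I_N) a : R := xm a / ev (q i) x.
have Ly i f : Lfun (y i) f = ev f x / ev (q i) x.
  rewrite /ev mevalE mulr_suml /Defs.Lfun; apply: eq_bigr => a _.
  by rewrite /y mulrA.
have qi i : ev (q i) x != 0 by rewrite gt_eqF // q0.
have psd i s (c : R) : 0 <= c ->
    psd_block s (I i) (fun a b => c * (xm a * xm b) / ev (q i) x).
  move=> c_ge0 v; pose t := \sum_(a : 'X_{1..n < s.+1} | supported_on (I i) a) v a * xm a.
  rewrite (_ : \sum_(_ | _) _ = (c / ev (q i) x) * t ^+ 2).
    by rewrite mulr_ge0 ?sqr_ge0 // divr_ge0 // ltW // q0.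
  rewrite expr2 {1}/t mulr_suml mulr_sumr; apply: eq_bigr => a _.
  by rewrite /t !mulr_sumr; apply: eq_bigr => b _; ring.
exists y; last by congr (_%:E); apply: eq_bigr => i _; rewrite Ly.
split.
- move=> i; apply: eq_psd_block (psd i k 1 ler01) => a b.
  by rewrite mul1r /y xmD.
- move=> i j jJ; apply: eq_psd_block (psd i _ _ (Kx j)) => a b.
  rewrite /locent /ev mevalE !mulr_suml; apply: eq_bigr => c _.
  by rewrite /y !xmD -/(xm c); ring.
- by move=> i; rewrite Ly divff.
- by move=> i j _ _ a _ _; rewrite !Ly /ev !mevalM -!/(ev _ x) !mulfK.
Qed.

End Relaxations.

(** * Convergence of the hierarchy *)

Section Convergence.
Variables (R : realType) (n m N : nat) (p q : 'I_N.+1 -> mpol R n)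
  (g : 'I_m -> mpol R n) (I : 'I_N.+1 -> {set 'I_n}) (J : 'I_N.+1 -> {set 'I_m}).
Hypotheses (Jcover : (\bigcup_(i < N.+1) J i)%SET = [set: 'I_m]%SET)
  (pqI : forall i, poly_in (I i) (p i) && poly_in (I i) (q i))
  (gI : forall i j, j \in J i -> poly_in (I i) (g j))
  (ballJ : forall i, exists2 k, k \in J i &
     exists2 M : R, 0 < M & g k = M%:MP - \sum_(l in I i) ('X_l) ^+ 2)
  (RIP : forall i : 'I_N.+1, (1 <= i)%N -> exists2 k : 'I_N.+1, (k < i)%N &
     (I i :&: \bigcup_(j : 'I_N.+1 | (j < i)%N) I j \subset I k)%SET)
  (q0 : forall i (x : 'rV[R]_n),
     (forall j, j \in J i -> 0 <= ev (g j) x) -> 0 < ev (q i) x).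

Lemma poly_in_mono (S : {set 'I_n}) a : supported_on S a -> poly_in S ('X_[a] : mpol R n).
Proof. by move=> aS; apply/poly_inP => b; rewrite msuppX inE => /eqP ->. Qed.

(** One ultrafilter serves all cliques, so the linking equalities survive in the limit and
    [sparse_lower_bound] applies to the limit functionals. *)
Lemma feasible_limit_bound (b b' : R) (y : nat -> 'I_N.+1 -> mono n -> R) :
  (forall x, Kset g x -> b < \sum_(i < N.+1) ev (p i) x / ev (q i) x) ->
  (forall k, feas_c p q g I J k (y k)) -> (forall k, obj p (y k) <= b') -> b <= b'.
Proof.
move=> bK yfeas yb.
have /choice[M HM] : forall i, exists M : R, 0 < M /\
    exists2 k, k \in J i & g k = ball_poly (I i) M.
  by move=> i; have [k kJ [M M0 gk]] := ballJ i; exists M; split => //; exists k.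
pose c : R := 1 + \sum_i M i.
have sM0 : 0 <= \sum_i M i by apply: sumr_ge0 => i _; case: (HM i) => /ltW.
have c0 : 0 < c by rewrite ltr_pwDl.
have Mc i : M i <= c ^+ 2.
  have Mi : M i <= \sum_i M i.
    by rewrite (bigD1 i) //= lerDl sumr_ge0 // => j _; case: (HM j) => /ltW.
  apply: (le_trans Mi); rewrite /c; nra.
have [U [UU Uoo]] := @ultraFilterLemma nat \oo _.
have UP : ProperFilter U := @ultra_proper _ U UU.
pose yt i k := trunc (I i) (y k i).
have pI i : poly_in (I i) (p i) by case/andP: (pqI i).
have qI i : poly_in (I i) (q i) by case/andP: (pqI i).
have /choice[z Hz] : forall i, exists z : mono n -> R,
  [/\ forall f, Lfun (yt i k) f @[k --> U] --> Lfun z f,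
      pos_mul (Lfun z) 1,
      forall j, j \in J i -> pos_mul (Lfun z) (g j) &
      forall l, pos_mul (Lfun z) (c%:MP + 'X_l) /\ pos_mul (Lfun z) (c%:MP - 'X_l)].
  move=> i; have [Mi0 [k kJ gk]] := HM i.
  apply: (@limit_functional R n m g (J i) (I i) (M i) c (q i) k) => //.
  - by move=> s a aI; rewrite /yt /trunc (negbTE aI).
  - by move=> s h hs; apply: psd_block_trunc1 hs; case: (yfeas s).
  - move=> s j h jJ hs; apply: psd_block_trunc (gI jJ) _ hs.
    by case: (yfeas s) => _ H _ _; exact: H.
  - by move=> s; rewrite Lfun_trunc //; case: (yfeas s).
  - by move=> x [_ gx]; exact: q0.
have Lz i f : Lfun (yt i k) f @[k --> U] --> Lfun (z i) f by case: (Hz i).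
have one i : Lfun (z i) (q i) = 1.
  apply: (cvg_unique (@Rhausdorff R) (Lz i (q i))).
  apply: cvg_near_cst; apply: nearW => k.
  by rewrite Lfun_trunc //; case: (yfeas k).
have link_lt (i j : 'I_N.+1) a : (i < j)%N -> supported_on (I i :&: I j)%SET a ->
    Lfun (z i) ('X_[a] * q i) = Lfun (z j) ('X_[a] * q j).
  (* Disjoint cliques carry no linking constraint, but then only [a = 0] remains and both sides are
     1. *)
  move=> ij aS; have [IJ0|IJ0] := eqVneq (I i :&: I j)%SET finset.set0.
    have -> : a = 0%MM.
      apply/mnmP => l; rewrite mnm0E; move/supported_onP: aS; apply.
      by rewrite IJ0 inE.
    by rewrite mpolyX0 !mul1r !one.
  apply: (cvg_unique (@Rhausdorff R) (Lz i ('X_[a] * q i))).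
  apply: cvg_trans (Lz j ('X_[a] * q j)); apply: near_eq_cvg; apply: Uoo; near=> k.
  have aij : supported_on (I i) a /\ supported_on (I j) a.
    by move/supported_onP: aS => aS; split; apply/supported_onP => l lI;
      apply: aS; rewrite inE (negbTE lI) ?andbF.
  rewrite !Lfun_trunc; try by apply: poly_inM => //; apply: poly_in_mono; case: aij.
  case: (yfeas k) => _ _ _ H; apply/esym/(H i j) => //.
  have : (mdeg a + maxn (pdeg (q i)) (pdeg (q j)) <= k)%N by near: k; exact: nbhs_infty_ge.
  clear; rewrite /Defs.mdeg; move: (mdeg a) (maxn _ _) => d e; lia.
have link (i j : 'I_N.+1) a : supported_on (I i :&: I j)%SET a ->
    Lfun (z i) ('X_[a] * q i) = Lfun (z j) ('X_[a] * q j).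
  move=> aS; have [ij|ji|/val_inj -> //] := ltngtP i j; first exact: link_lt.
  by apply/esym/link_lt => //; rewrite finset.setIC.
have bz : b <= \sum_i Lfun (z i) (p i).
  apply: (@sparse_lower_bound R n m N p q g I J c b (fun i => Lfun (z i))) => //.
  - by move=> i x [_ gx]; exact: q0.
  - by move=> i; case: (Hz i).
  - by move=> i l; case: (Hz i) => _ _ _ /(_ l) [].
  - by move=> i l; case: (Hz i) => _ _ _ /(_ l) [].
  - by move=> i j jJ; case: (Hz i) => _ _ + _; apply.
  move=> x Kx; apply: bK => j.
  have : j \in (\bigcup_(i < N.+1) J i)%SET by rewrite Jcover inE.
  by case/bigcupP => i _ jJ; case: (Kx i) => _; apply.
have Lsum : \sum_i Lfun (yt i k) (p i) @[k --> U] --> \sum_i Lfun (z i) (p i).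
  by apply: cvg_sumr => i _; exact: Lz.
apply: (le_trans bz); apply: (cvgr_to_le Lsum).
apply: nearW => k; apply: le_trans (yb k); rewrite /obj.
by apply: ler_sum => i _; rewrite Lfun_trunc.
Unshelve. all: by end_near. Qed.

(** A monotone sequence tends to its supremum. If that were below [rho], reals [b' < b] would fit
    between, and feasible points of every order with objective at most [b'] would contradict
    [feasible_limit_bound]. *)
Theorem rho_c_cvg : (forall i x, Kset g x -> 0 < ev (q i) x) ->
  rho_c p q g I J k @[k --> \oo] --> rho p q g.
Proof.
move=> q0K; set u := rho_c p q g I J.
have u_nd : nondecreasing_seq u by move=> k1 k2 k12; exact: rho_c_le.
suff <- : ereal_sup (range u) = rho p q g by exact: ereal_nondecreasing_cvgn.
apply/eqP; rewrite eq_le; apply/andP; split.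
  by apply: ge_ereal_sup => _ [k _ <-]; exact: rho_c_le_rho.
rewrite leNgt; apply/negP => sup_lt.
have [b' [b [b'b sup_b' b_rho]]] : exists b' b : R,
    [/\ b' < b, (ereal_sup (range u) < b'%:E)%E & (b%:E < rho p q g)%E].
  (* Infinite values are treated too; for instance [rho] is [+oo] when [Kset g] is empty. *)
  move: sup_lt; case: (ereal_sup _) (rho p q g) => [s| |] [r| |] //.
  - rewrite lte_fin => sr; exists (s + (r - s) / 3), (s + (r - s) * 2 / 3).
    by rewrite !lte_fin; split; lra.
  - by move=> _; exists (s + 1), (s + 2); rewrite lte_fin ltry; split => //; lra.
  - by move=> _; exists (r - 2), (r - 1); rewrite lte_fin ltNyr; split => //; lra.
  - by move=> _; exists 0, 1; rewrite ltry ltNyr; split.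
have /choice[y Hy] : forall k, exists y, feas_c p q g I J k y /\ obj p y <= b'.
  move=> k; have uk : (u k < b'%:E)%E.
    by apply: le_lt_trans sup_b'; apply: ereal_sup_ubound; exists k.
  have [_ [y yf <-]] := ereal_inf_lt uk; rewrite lte_fin => yb.
  by exists y; split => //; exact: ltW.
suff : b <= b' by rewrite leNgt b'b.
apply: (@feasible_limit_bound b b' y) => [x Kx|k|k]; last 2 first.
- by case: (Hy k).
- by case: (Hy k).
rewrite -lte_fin; apply: (lt_le_trans b_rho).
by apply: ereal_inf_lbound; exists x.
Qed.

End Convergence.

Theorem theorem4p15 (R : realType) (n m N : nat)
  (p q : 'I_N -> mpol R n) (g : 'I_m -> mpol R n)
  (I : 'I_N -> {set 'I_n}) (J : 'I_N -> {set 'I_m}) :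
  (0 < n)%N -> (0 < m)%N -> (0 < N)%N ->
  compact (Kset g) ->
  (forall i x, Kset g x -> 0 < ev (q i) x) ->
  (\bigcup_(i < N) I i)%SET = [set: 'I_n]%SET ->
  (\bigcup_(i < N) J i)%SET = [set: 'I_m]%SET ->
  (* (i) *)
  (forall i, poly_in (I i) (p i) && poly_in (I i) (q i)) ->
  (* (ii) *)
  (forall i j, j \in J i -> poly_in (I i) (g j)) ->
  (* (iii) *)
  (forall i, exists2 k, k \in J i &
     exists2 M : R, 0 < M &
       g k = M%:MP - \sum_(l in I i) ('X_l) ^+ 2) ->
  (* (iv) running intersection property *)
  (forall i : 'I_N, (1 <= i)%N ->
     exists2 k : 'I_N, (k < i)%N &
       (I i :&: \bigcup_(j : 'I_N | (j < i)%N) I j \subset I k)%SET) ->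
  (* q_i > 0 on K_i *)
  (forall i (x : 'rV[R]_n),
     (forall j, j \in J i -> 0 <= ev (g j) x) -> 0 < ev (q i) x) ->
  (forall k, (dmin p q g <= k)%N -> rho_cs p q g I J k = rho_c p q g I J k)
  /\ (forall k1 k2, (dmin p q g <= k1)%N -> (k1 <= k2)%N ->
        (rho_cs p q g I J k1 <= rho_cs p q g I J k2)%E)
  /\ (rho_cs p q g I J k @[k --> \oo] --> rho p q g).
Proof.
move=> _ _ N0 _ qK _ Jcover pqI gI ballJ RIP q0.
split; first by move=> k _; exact: rho_cs_eq.
split; first by move=> k1 k2 _ k12; rewrite !rho_cs_eq; exact: rho_c_le.
case: N N0 p q I J qK Jcover pqI gI ballJ RIP q0 => // N' _ p' q' I' J'.
move=> qK Jcover pqI gI ballJ RIP q0.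
rewrite (_ : rho_cs p' q' g I' J' = rho_c p' q' g I' J').
  exact: rho_c_cvg.
by apply/funext => k; exact: rho_cs_eq.
Qed.
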